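(* Let $k$ be a field, $Q^*$ a finite quiver, $I^*$ an admissible ideal in $kQ^*$ and $\Gamma=kQ^*/I^*$. Let $P$ be the projective $\Gamma$-$\Gamma$-bimodule $P=\bigoplus_{i=1}^t\Gamma e_i\otimes_kf_i\Gamma$ for some trivial paths $e_i$ and $f_i$ in $Q^*$, $i=1,2,\dots,t$. Suppose that $\operatorname{Hom}_\Gamma(e_i\Gamma,f_j\Gamma)=0$ for all $i$ and $j$ in $\{1,2,\dots,t\}$. (i) The trivial extension $\Lambda=\Gamma\ltimes P$ is isomorphic to a quotient $kQ/I$, where $Q$ has the same vertices and the same arrows as $Q^*$ with one arrow $a_i\colon v_{e_i}\to v_{f_i}$ added for each indecomposable summand $\Gamma e_i\otimes_kf_i\Gamma$ of $P$, and $I=\langle I^*\rangle$ is the ideal of $kQ$ generated by $I^*$. (ii) The arrows $a_i$ do not occur in a minimal set of generators for the relations $I$, and $\operatorname{Hom}_\Lambda(e_i\Lambda,f_j\Lambda)=0$ for all $i$ and $j$ in $\{1,2,\dots,t\}$.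
   Context: An ideal $I^*$ of $kQ^*$ is admissible if $J^m\subseteq I^*\subseteq J^2$ for some $m\ge2$, where $J$ is the ideal generated by the arrows. Paths are composed from left to right; for a trivial path (primitive idempotent) $e$ the corresponding vertex is $v_e$, and an arrow $a\colon v_e\to v_f$ satisfies $a=eaf$. The same symbols denote the images of trivial paths in quotient algebras. Modules are right modules. For a $\Gamma$-$\Gamma$-bimodule $P$, the trivial extension $\Gamma\ltimes P$ is $\Gamma\oplus P$ with multiplication $(\gamma,p)(\gamma',p')=(\gamma\gamma',\gamma p'+p\gamma')$. ''The arrows $a_i$ do not occur in a minimal set of generators for $I$'' means that there is a minimal generating set of the two-sided ideal $I$ such that none of the $a_i$ occurs in any path appearing (with non-zero coefficient) in any element of that set. *)

(* Defs.v *)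
From HB Require Import structures.
From mathcomp Require Import all_boot all_algebra.
From mathcomp Require Import finmap.
From mathcomp Require Import boolp classical_sets.
From mathcomp.multinomials Require Import monalg.

Set Implicit Arguments.
Unset Strict Implicit.
Unset Printing Implicit Defensive.

Import GRing.Theory.
Local Open Scope ring_scope.
Local Open Scope quotient_scope.
Local Open Scope classical_set_scope.

(* The library's [algType] requires [1 != 0], which fails for the path algebra of
   the empty quiver and for a quotient by the unit ideal. *)

Record kalgebra (k : fieldType) := KAlgebra {
  kalg_carrier : lmodType k;
  kalg_mul : kalg_carrier -> kalg_carrier -> kalg_carrier;
  kalg_one : kalg_carrier;
  kalg_mulA : associative kalg_mul;
  kalg_mul1 : left_id kalg_one kalg_mul;
  kalg_mulr1 : right_id kalg_one kalg_mul;
  kalg_mulDl : left_distributive kalg_mul +%R;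
  kalg_mulDr : right_distributive kalg_mul +%R;
  kalg_scaleAl : forall c x y, c *: kalg_mul x y = kalg_mul (c *: x) y;
  kalg_scaleAr : forall c x y, c *: kalg_mul x y = kalg_mul x (c *: y)
}.

Definition kalg_sort (k : fieldType) (A : kalgebra k) : Type := kalg_carrier A.
Coercion kalg_sort : kalgebra >-> Sortclass.
Arguments kalg_sort : simpl never.

Section KAlgebraTheory.
Variables (k : fieldType) (A : kalgebra k).

HB.instance Definition _ := GRing.Lmodule.on (kalg_sort A).
HB.instance Definition _ := GRing.Zmodule_isPzRing.Build (kalg_sort A)
  (@kalg_mulA _ A) (@kalg_mul1 _ A) (@kalg_mulr1 _ A)
  (@kalg_mulDl _ A) (@kalg_mulDr _ A).

Lemma kscalerAl (c : k) (x y : A) : c *: (x * y) = (c *: x) * y.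
Proof. exact: kalg_scaleAl. Qed.
Lemma kscalerAr (c : k) (x y : A) : c *: (x * y) = x * (c *: y).
Proof. exact: kalg_scaleAr. Qed.

End KAlgebraTheory.

Definition alg_isomorphism (k : fieldType) (A B : kalgebra k)
    (phi : {linear A -> B}) : Prop :=
  bijective phi /\ monoid_morphism phi.

(* Allows [W x] for a record [W] that coerces to [set]. *)
Identity Coercion set_to_fun : set >-> Funclass.

Record submodule (k : fieldType) (V : lmodType k) := Submodule {
  submodule_set :> set V;
  submodule0 : submodule_set 0;
  submoduleP : forall (c : k) x y, submodule_set x -> submodule_set y ->
    submodule_set (c *: x + y)
}.

(* [locked_with lock_key] below only keeps unification fast. *)
Fact lock_key : unit. Proof. exact: tt. Qed.

Section Quotient.
Variables (k : fieldType) (V : lmodType k) (W : submodule V).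

Lemma submoduleD x y : W x -> W y -> W (x + y).
Proof. by move=> Wx Wy; rewrite -[x]scale1r; apply: submoduleP. Qed.

Lemma submoduleZ c x : W x -> W (c *: x).
Proof. by move=> Wx; rewrite -[_ *: _]addr0; apply: submoduleP (submodule0 W). Qed.

Lemma submoduleN x : W x -> W (- x).
Proof. by move=> Wx; rewrite -scaleN1r; apply: submoduleZ. Qed.

Definition quot_rel : rel V := fun x y => `[< W (x - y) >].

Fact quot_rel_refl : reflexive quot_rel.
Proof. by move=> x; apply/asboolP; rewrite subrr; apply: submodule0. Qed.

Fact quot_rel_sym : symmetric quot_rel.
Proof.
move=> x y; apply/asboolP/asboolP => /submoduleN; by rewrite opprB.
Qed.

Fact quot_rel_trans : transitive quot_rel.
Proof.
move=> y x z /asboolP xy /asboolP yz; apply/asboolP.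
by rewrite -[x](subrK y) -addrA; apply: submoduleD.
Qed.

Canonical quot_equiv :=
  EquivRel quot_rel quot_rel_refl quot_rel_sym quot_rel_trans.

Definition quot : Type := {eq_quot quot_rel}.
HB.instance Definition _ := Choice.on quot.

Definition quot_pi : V -> quot := locked_with lock_key \pi_{eq_quot quot_rel}.
Definition quot_repr : quot -> V :=
  locked_with lock_key (fun q : {eq_quot quot_rel} => repr q).

Lemma quot_reprK : cancel quot_repr quot_pi.
Proof. by move=> q; rewrite /quot_pi /quot_repr !locked_withE reprK. Qed.

Lemma quot_piP x y : quot_pi x = quot_pi y <-> W (x - y).
Proof.
rewrite /quot_pi locked_withE; split=> [xy|Wxy].
  by move/(@eqmodP _ quot_equiv)/asboolP: xy.
by apply/(@eqmodP _ quot_equiv)/asboolP.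
Qed.

Lemma quot_ind (P : quot -> Prop) : (forall x, P (quot_pi x)) -> forall q, P q.
Proof. by move=> Pp q; rewrite -(quot_reprK q). Qed.

Lemma quot_reprP x : W (quot_repr (quot_pi x) - x).
Proof. by apply/quot_piP; rewrite quot_reprK. Qed.

Definition quot_add (p q : quot) := quot_pi (quot_repr p + quot_repr q).
Definition quot_opp (p : quot) := quot_pi (- quot_repr p).
Definition quot_scale (c : k) (p : quot) := quot_pi (c *: quot_repr p).

Fact quot_addE x y : quot_add (quot_pi x) (quot_pi y) = quot_pi (x + y).
Proof.
apply/quot_piP; rewrite opprD addrACA.
by apply: submoduleD; apply: quot_reprP.
Qed.

Fact quot_oppE x : quot_opp (quot_pi x) = quot_pi (- x).
Proof. by apply/quot_piP; rewrite -opprD; apply: submoduleN; apply: quot_reprP. Qed.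

Fact quot_scaleE c x : quot_scale c (quot_pi x) = quot_pi (c *: x).
Proof.
by apply/quot_piP; rewrite -scalerBr; apply: submoduleZ; apply: quot_reprP.
Qed.

Fact quot_addA : associative quot_add.
Proof.
elim/quot_ind=> x; elim/quot_ind=> y; elim/quot_ind=> z.
by rewrite !quot_addE addrA.
Qed.
Fact quot_addC : commutative quot_add.
Proof. by elim/quot_ind=> x; elim/quot_ind=> y; rewrite !quot_addE addrC. Qed.
Fact quot_add0 : left_id (quot_pi 0) quot_add.
Proof. by elim/quot_ind=> x; rewrite quot_addE add0r. Qed.
Fact quot_addN : left_inverse (quot_pi 0) quot_opp quot_add.
Proof. by elim/quot_ind=> x; rewrite quot_oppE quot_addE addNr. Qed.

HB.instance Definition _ :=
  GRing.isZmodule.Build quot quot_addA quot_addC quot_add0 quot_addN.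

Fact quot_scaleA a b v : quot_scale a (quot_scale b v) = quot_scale (a * b) v.
Proof. by elim/quot_ind: v => x; rewrite !quot_scaleE scalerA. Qed.
Fact quot_scale1 : left_id 1 quot_scale.
Proof. by elim/quot_ind=> x; rewrite quot_scaleE scale1r. Qed.
Fact quot_scaleDr : right_distributive quot_scale +%R.
Proof.
move=> c; elim/quot_ind=> x; elim/quot_ind=> y.
change (quot_scale c (quot_add (quot_pi x) (quot_pi y)) =
  quot_add (quot_scale c (quot_pi x)) (quot_scale c (quot_pi y))).
by rewrite quot_addE !quot_scaleE quot_addE scalerDr.
Qed.
Fact quot_scaleDl v : {morph quot_scale^~ v : a b / a + b}.
Proof.
move=> a b; elim/quot_ind: v => x.
by rewrite !quot_scaleE -[RHS]/(quot_add _ _) quot_addE scalerDl.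
Qed.

HB.instance Definition _ := GRing.Zmodule_isLmodule.Build k quot
  quot_scaleA quot_scale1 quot_scaleDr quot_scaleDl.

Fact quot_pi_is_linear : linear quot_pi.
Proof.
move=> c x y.
by rewrite -[RHS]/(quot_add (quot_scale _ _) _) quot_scaleE quot_addE.
Qed.
HB.instance Definition _ := GRing.isLinear.Build k V quot *:%R quot_pi
  quot_pi_is_linear.

Lemma quot_piZ c x : quot_pi (c *: x) = c *: quot_pi x.
Proof. exact: linearZ. Qed.

Lemma quot_pi_eq0 x : quot_pi x = 0 <-> W x.
Proof. by rewrite -[0](linear0 quot_pi) quot_piP subr0. Qed.

Definition quot_lift (V' : lmodType k) (F : V -> V') (q : quot) : V' :=
  F (quot_repr q).

Section Lift.
Variables (V' : lmodType k) (F : {linear V -> V'}).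
Hypothesis FW : forall x, W x -> F x = 0.

Lemma quot_liftE x : quot_lift F (quot_pi x) = F x.
Proof. by apply/eqP; rewrite -subr_eq0 -linearB FW //; apply: quot_reprP. Qed.

Lemma quot_lift_is_linear : linear (quot_lift F).
Proof.
move=> c; elim/quot_ind=> x; elim/quot_ind=> y.
by rewrite -linearP !quot_liftE linearP.
Qed.
End Lift.

End Quotient.

Section SubmoduleGen.
Variables (k : fieldType) (V : lmodType k) (S : set V).

Definition submodule_gen_set : set V :=
  [set x | forall W : submodule V, S `<=` W -> W x].

Fact submodule_gen0 : submodule_gen_set 0.
Proof. by move=> W _; apply: submodule0. Qed.

Fact submodule_genP c x y : submodule_gen_set x -> submodule_gen_set y ->
  submodule_gen_set (c *: x + y).
Proof. by move=> Sx Sy W SW; apply: submoduleP; [apply: Sx | apply: Sy]. Qed.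

Definition submodule_gen := Submodule submodule_gen0 submodule_genP.

Lemma sub_submodule_gen : S `<=` submodule_gen.
Proof. by move=> x Sx W; apply. Qed.

End SubmoduleGen.

Section Kernel.
Variables (k : fieldType) (V V' : lmodType k) (F : {linear V -> V'}).

Fact kernel0 : [set x | F x = 0] 0.
Proof. exact: linear0. Qed.
Fact kernelP c x y : [set x | F x = 0] x -> [set x | F x = 0] y ->
  [set x | F x = 0] (c *: x + y).
Proof. by move=> /= Fx Fy; rewrite linearP Fx Fy scaler0 addr0. Qed.

Definition kernel := Submodule kernel0 kernelP.
End Kernel.

Record ideal (k : fieldType) (A : kalgebra k) := Ideal {
  ideal_set :> set A;
  ideal0 : ideal_set 0;
  idealD : forall x y, ideal_set x -> ideal_set y -> ideal_set (x + y);
  idealMl : forall a x, ideal_set x -> ideal_set (a * x);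
  idealMr : forall a x, ideal_set x -> ideal_set (x * a)
}.

Section IdealQuotient.
Variables (k : fieldType) (A : kalgebra k) (I : ideal A).

Fact ideal_submoduleP (c : k) (x y : A) : I x -> I y -> I (c *: x + y).
Proof.
move=> Ix Iy; apply: idealD => //.
by rewrite -[x]mul1r kscalerAl; apply: idealMl.
Qed.

Definition ideal_submodule : submodule A :=
  Submodule (@ideal0 _ _ I) ideal_submoduleP.

Local Notation pi := (quot_pi ideal_submodule).

Definition quot_mul (p q : quot ideal_submodule) : quot ideal_submodule :=
  pi ((quot_repr p : A) * (quot_repr q : A)).

Fact quot_mulE (x y : A) : quot_mul (pi x) (pi y) = pi (x * y).
Proof.
apply/quot_piP => /=; have Ix := quot_reprP ideal_submodule x.
have Iy := quot_reprP ideal_submodule y; rewrite /= in Ix Iy.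
set x' : A := quot_repr _; set y' : A := quot_repr _.
have -> : x' * y' - x * y = (x' - x) * y' + x * (y' - y).
  by rewrite mulrBl mulrBr addrA subrK.
by apply: idealD; [apply: idealMr | apply: idealMl].
Qed.

Fact quot_mulA : associative quot_mul.
Proof.
elim/quot_ind=> x; elim/quot_ind=> y; elim/quot_ind=> z.
by rewrite !quot_mulE mulrA.
Qed.
Fact quot_mul1 : left_id (pi (1 : A)) quot_mul.
Proof. by elim/quot_ind=> x; rewrite quot_mulE mul1r. Qed.
Fact quot_mulr1 : right_id (pi (1 : A)) quot_mul.
Proof. by elim/quot_ind=> x; rewrite quot_mulE mulr1. Qed.
Fact quot_mulDl : left_distributive quot_mul +%R.
Proof.
elim/quot_ind=> x; elim/quot_ind=> y; elim/quot_ind=> z.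
by rewrite -linearD !quot_mulE -linearD mulrDl.
Qed.
Fact quot_mulDr : right_distributive quot_mul +%R.
Proof.
elim/quot_ind=> x; elim/quot_ind=> y; elim/quot_ind=> z.
by rewrite -linearD !quot_mulE -linearD mulrDr.
Qed.
Fact quot_scalerAl (c : k) p q : c *: quot_mul p q = quot_mul (c *: p) q.
Proof.
elim/quot_ind: p => x; elim/quot_ind: q => y.
by rewrite -(quot_piZ _ c x) !quot_mulE -(quot_piZ _ c (x * y)) kscalerAl.
Qed.
Fact quot_scalerAr (c : k) p q : c *: quot_mul p q = quot_mul p (c *: q).
Proof.
elim/quot_ind: p => x; elim/quot_ind: q => y.
by rewrite -(quot_piZ _ c y) !quot_mulE -(quot_piZ _ c (x * y)) kscalerAr.
Qed.

Definition quot_alg : kalgebra k := KAlgebra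
  quot_mulA quot_mul1 quot_mulr1 quot_mulDl quot_mulDr
  quot_scalerAl quot_scalerAr.

Definition quot_alg_pi (x : A) : quot_alg := pi x.

Fact quot_alg_pi_is_linear : linear quot_alg_pi.
Proof. exact: quot_pi_is_linear. Qed.
HB.instance Definition _ := GRing.isLinear.Build k A quot_alg *:%R quot_alg_pi
  quot_alg_pi_is_linear.

Fact quot_alg_pi_is_monoid_morphism : monoid_morphism quot_alg_pi.
Proof. by split=> // x y; apply/esym; exact: quot_mulE. Qed.
HB.instance Definition _ := GRing.isMonoidMorphism.Build A quot_alg quot_alg_pi
  quot_alg_pi_is_monoid_morphism.

Lemma quot_alg_ind (P : quot_alg -> Prop) :
  (forall x, P (quot_alg_pi x)) -> forall q, P q.
Proof. exact: quot_ind. Qed.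

Lemma quot_alg_pi_eq0 x : quot_alg_pi x = 0 <-> I x.
Proof. exact: quot_pi_eq0. Qed.

End IdealQuotient.

Section IdealOperations.
Variables (k : fieldType) (A : kalgebra k).

Definition ideal_gen_set (S : set A) : set A :=
  [set x | forall I : ideal A, S `<=` I -> I x].

Fact ideal_gen0 S : ideal_gen_set S 0.
Proof. by move=> I _; apply: ideal0. Qed.
Fact ideal_genD S x y :
  ideal_gen_set S x -> ideal_gen_set S y -> ideal_gen_set S (x + y).
Proof. by move=> Sx Sy I SI; apply: idealD; [apply: Sx | apply: Sy]. Qed.
Fact ideal_genMl S a x : ideal_gen_set S x -> ideal_gen_set S (a * x).
Proof. by move=> Sx I SI; apply: idealMl; apply: Sx. Qed.
Fact ideal_genMr S a x : ideal_gen_set S x -> ideal_gen_set S (x * a).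
Proof. by move=> Sx I SI; apply: idealMr; apply: Sx. Qed.

Definition ideal_gen (S : set A) : ideal A :=
  Ideal (@ideal_gen0 S) (@ideal_genD S) (@ideal_genMl S) (@ideal_genMr S).

Definition ideal_mul (I J : ideal A) : ideal A :=
  ideal_gen [set x * y | x in I & y in J].

Fixpoint ideal_exp (I : ideal A) (n : nat) : ideal A :=
  if n is n'.+1 then ideal_mul I (ideal_exp I n') else ideal_gen setT.

Definition minimal_generating_set (I : ideal A) (S : set A) : Prop :=
  ideal_gen S = I :> set A /\
  forall S' : set A, S' `<=` S -> ideal_gen S' = I :> set A -> S' = S.

End IdealOperations.

Section LinearExtension.
Variables (k : fieldType) (K : choiceType) (V : lmodType k).

Definition lin_ext : (K -> V) -> {malg k[K]} -> V :=
  locked_with lock_key (fun f x => \sum_(i <- msupp x) x@_i *: f i).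

Lemma lin_extE f x : lin_ext f x = \sum_(i <- msupp x) x@_i *: f i.
Proof. by rewrite /lin_ext locked_withE. Qed.

Lemma lin_extEw (f : K -> V) (d : {fset K}) x : (msupp x `<=` d)%fset ->
  lin_ext f x = \sum_(i <- d) x@_i *: f i.
Proof.
move=> sxd; rewrite lin_extE; apply: big_fset_incl => // i _ /mcoeff_outdom ->.
by rewrite scale0r.
Qed.

Fact lin_ext_is_linear f : linear (lin_ext f).
Proof.
move=> c x y; pose d := (msupp x `|` msupp y)%fset.
have sx : (msupp x `<=` d)%fset by apply: fsubsetUl.
have sy : (msupp y `<=` d)%fset by apply: fsubsetUr.
rewrite (lin_extEw f sx) (lin_extEw f sy) (@lin_extEw f d); last first.
  apply: fsubset_trans (msuppD_le _ _) _.
  by apply: fsetSU; apply: msuppZ_le.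
rewrite scaler_sumr -big_split /=; apply: eq_bigr => i _.
by rewrite mcoeffD mcoeffZ scalerDl scalerA.
Qed.
HB.instance Definition _ f :=
  GRing.isLinear.Build k {malg k[K]} V *:%R (lin_ext f) (lin_ext_is_linear f).

Lemma lin_extU f c i : lin_ext f << c *g i >> = c *: f i.
Proof. by rewrite (lin_extEw f msuppU_le) big_seq_fset1 mcoeffUU. Qed.

Lemma malgU_scale c i : << c *g i >> = c *: << i >> :> {malg k[K]}.
Proof.
by apply/malgP => j; rewrite mcoeffZ !mcoeffU mulr_natr.
Qed.

Lemma lin_ext_eq (F G : {linear {malg k[K]} -> V}) :
  (forall i, F << i >> = G << i >>) -> F =1 G.
Proof.
move=> FG x; rewrite [x]monalgE !linear_sum; apply: eq_bigr => i _.
by rewrite malgU_scale !linearZ_LR FG.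
Qed.

End LinearExtension.

Section Tensor.
Variables (k : fieldType) (U V : lmodType k).

Definition tensor_relations : set {malg k[(U * V)%type]} :=
  [set z | exists c u u' v,
     z = << (c *: u + u', v) >> - (c *: << (u, v) >> + << (u', v) >>)] `|`
  [set z | exists c u v v',
     z = << (u, c *: v + v') >> - (c *: << (u, v) >> + << (u, v') >>)].

Definition tensor : Type := quot (submodule_gen tensor_relations).
HB.instance Definition _ := GRing.Lmodule.on tensor.

Definition tensor_pi : {malg k[(U * V)%type]} -> tensor :=
  quot_pi (submodule_gen tensor_relations).
HB.instance Definition _ := GRing.Linear.on tensor_pi.

Definition tens : U -> V -> tensor :=
  locked_with lock_key (fun u v => tensor_pi << (u, v) >>).

Lemma tensE u v : tens u v = tensor_pi << (u, v) >>.
Proof. by rewrite /tens locked_withE. Qed.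

Lemma tensPl c u u' v : tens (c *: u + u') v = c *: tens u v + tens u' v.
Proof.
rewrite !tensE -linearP; apply/quot_piP.
by apply: sub_submodule_gen; left; exists c, u, u', v.
Qed.

Lemma tensPr c u v v' : tens u (c *: v + v') = c *: tens u v + tens u v'.
Proof.
rewrite !tensE -linearP; apply/quot_piP.
by apply: sub_submodule_gen; right; exists c, u, v, v'.
Qed.

Lemma tens0l v : tens 0 v = 0.
Proof. by have := tensPl (-1) 0 0 v; rewrite !scaleN1r !addNr. Qed.
Lemma tens0r u : tens u 0 = 0.
Proof. by have := tensPr (-1) u 0 0; rewrite !scaleN1r !addNr. Qed.
Lemma tensDl u u' v : tens (u + u') v = tens u v + tens u' v.
Proof. by have := tensPl 1 u u' v; rewrite !scale1r. Qed.
Lemma tensDr u v v' : tens u (v + v') = tens u v + tens u v'.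
Proof. by have := tensPr 1 u v v'; rewrite !scale1r. Qed.
Lemma tensZl c u v : tens (c *: u) v = c *: tens u v.
Proof. by have := tensPl c u 0 v; rewrite tens0l !addr0. Qed.
Lemma tensZr c u v : tens u (c *: v) = c *: tens u v.
Proof. by have := tensPr c u v 0; rewrite tens0r !addr0. Qed.

Lemma tensor_eq (T : lmodType k) (F G : {linear tensor -> T}) :
  (forall u v, F (tens u v) = G (tens u v)) -> F =1 G.
Proof.
move=> FG; elim/quot_ind => x.
by apply: (@lin_ext_eq _ _ _ (F \o tensor_pi) (G \o tensor_pi)) => -[u v] /=; rewrite -tensE FG.
Qed.

Section Lift.
Variables (T : lmodType k) (b : U -> V -> T).

Definition tensor_lift : tensor -> T :=
  quot_lift (lin_ext (fun p : U * V => b p.1 p.2)).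

Hypothesis bPl : forall c u u' v, b (c *: u + u') v = c *: b u v + b u' v.
Hypothesis bPr : forall c u v v', b u (c *: v + v') = c *: b u v + b u v'.

Let killed x : submodule_gen tensor_relations x ->
  lin_ext (fun p : U * V => b p.1 p.2) x = 0.
Proof.
move=> /(_ (kernel (lin_ext (fun p : U * V => b p.1 p.2)))); apply.
by move=> z [] [c [u [u' [v ->]]]]; rewrite /= linearB linearP /= !lin_extU
  !scale1r /= ?bPl ?bPr subrr.
Qed.

Lemma tensor_liftE u v : tensor_lift (tens u v) = b u v.
Proof.
rewrite /tensor_lift tensE; apply: etrans (quot_liftE killed _) _.
by rewrite /= lin_extU scale1r.
Qed.

Lemma tensor_lift_is_linear : linear tensor_lift.
Proof. exact: quot_lift_is_linear killed. Qed.
End Lift.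

End Tensor.

Section TensorMap.
Variables (k : fieldType) (U V U' V' : lmodType k).
Variables (f : {linear U -> U'}) (g : {linear V -> V'}).

Definition tensor_map : tensor U V -> tensor U' V' :=
  tensor_lift (fun u v => tens (f u) (g v)).

Let bPl c u u' v :
  tens (f (c *: u + u')) (g v) = c *: tens (f u) (g v) + tens (f u') (g v).
Proof. by rewrite linearP tensPl. Qed.
Let bPr c u v v' :
  tens (f u) (g (c *: v + v')) = c *: tens (f u) (g v) + tens (f u) (g v').
Proof. by rewrite linearP tensPr. Qed.

Fact tensor_map_is_linear : linear tensor_map.
Proof. exact: tensor_lift_is_linear bPl bPr. Qed.
HB.instance Definition _ := GRing.isLinear.Build k (tensor U V) (tensor U' V')
  *:%R tensor_map tensor_map_is_linear.

Lemma tensor_mapE u v : tensor_map (tens u v) = tens (f u) (g v).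
Proof. exact: tensor_liftE bPl bPr u v. Qed.
End TensorMap.

Section OneSided.
Variables (k : fieldType) (A : kalgebra k) (e : A).

Definition lideal_pred : {pred A} := fun x => `[< exists y, x = y * e >].
Definition rideal_pred : {pred A} := fun x => `[< exists y, x = e * y >].

Fact lideal_submod_closed : submod_closed lideal_pred.
Proof.
split; first by apply/asboolP; exists 0; rewrite mul0r.
move=> c x y /asboolP[x' ->] /asboolP[y' ->]; apply/asboolP.
by exists (c *: x' + y'); rewrite mulrDl kscalerAl.
Qed.
HB.instance Definition _ :=
  GRing.isSubmodClosed.Build k A lideal_pred lideal_submod_closed.

Fact rideal_submod_closed : submod_closed rideal_pred.
Proof.
split; first by apply/asboolP; exists 0; rewrite mulr0.
move=> c x y /asboolP[x' ->] /asboolP[y' ->]; apply/asboolP.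
by exists (c *: x' + y'); rewrite mulrDr kscalerAr.
Qed.
HB.instance Definition _ :=
  GRing.isSubmodClosed.Build k A rideal_pred rideal_submod_closed.

Record lideal : predArgType :=
  Lideal { lideal_val : A; lideal_valP : lideal_val \in lideal_pred }.
HB.instance Definition _ := [isSub for lideal_val].
HB.instance Definition _ := [Choice of lideal by <:].
HB.instance Definition _ := [SubChoice_isSubLmodule of lideal by <:].

Record rideal : predArgType :=
  Rideal { rideal_val : A; rideal_valP : rideal_val \in rideal_pred }.
HB.instance Definition _ := [isSub for rideal_val].
HB.instance Definition _ := [Choice of rideal by <:].
HB.instance Definition _ := [SubChoice_isSubLmodule of rideal by <:].

Fact lideal_mul_subproof (a : A) (x : lideal) : a * val x \in lideal_pred.
Proof.
by case: x => x /= /asboolP[y ->]; apply/asboolP; exists (a * y); rewrite mulrA.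
Qed.
Definition lideal_mul (a : A) (x : lideal) : lideal :=
  Lideal (lideal_mul_subproof a x).

Fact rideal_mul_subproof (a : A) (x : rideal) : val x * a \in rideal_pred.
Proof.
by case: x => x /= /asboolP[y ->]; apply/asboolP; exists (y * a); rewrite mulrA.
Qed.
Definition rideal_mul (a : A) (x : rideal) : rideal :=
  Rideal (rideal_mul_subproof a x).

Fact lideal_mul_is_linear a : linear (lideal_mul a).
Proof.
by move=> c x y; apply: val_inj; rewrite /= mulrDr kscalerAr.
Qed.
HB.instance Definition _ a := GRing.isLinear.Build k lideal lideal *:%R
  (lideal_mul a) (lideal_mul_is_linear a).

Fact rideal_mul_is_linear a : linear (rideal_mul a).
Proof.
by move=> c x y; apply: val_inj; rewrite /= mulrDl kscalerAl.
Qed.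
HB.instance Definition _ a := GRing.isLinear.Build k rideal rideal *:%R
  (rideal_mul a) (rideal_mul_is_linear a).

(* A right A-module is a module over the converse ring [A^c]; [rmod] is the
   vector space [e A] with this other module structure. *)
Definition rmod : Type := rideal.
HB.instance Definition _ := GRing.Zmodule.on rmod.

Definition rmod_scale (a : A^c) (x : rmod) : rmod := rideal_mul a x.

Fact rmod_scaleA a b x : rmod_scale a (rmod_scale b x) = rmod_scale (a * b) x.
Proof. by apply: val_inj => /=; rewrite -mulrA. Qed.
Fact rmod_scale1 : left_id 1 rmod_scale.
Proof. by move=> x; apply: val_inj => /=; rewrite mulr1. Qed.
Fact rmod_scaleDr : right_distributive rmod_scale +%R.
Proof. by move=> a x y; apply: val_inj => /=; rewrite mulrDl. Qed.
Fact rmod_scaleDl x : {morph rmod_scale^~ x : a b / a + b}.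
Proof. by move=> a b; apply: val_inj => /=; rewrite mulrDr. Qed.
HB.instance Definition _ := GRing.Zmodule_isLmodule.Build A^c rmod
  rmod_scaleA rmod_scale1 rmod_scaleDr rmod_scaleDl.

End OneSided.

Definition Hom_zero (k : fieldType) (A : kalgebra k) (e f : A) : Prop :=
  forall h : {linear rmod e -> rmod f}, forall x, h x = 0.

(* The last two axioms say that [k] acts centrally. *)
Record bimodule (k : fieldType) (A : kalgebra k) := Bimodule {
  bimodule_sort :> lmodType k;
  lact : A -> bimodule_sort -> bimodule_sort;
  ract : bimodule_sort -> A -> bimodule_sort;
  lactA : forall (a b : A) p, lact (a * b) p = lact a (lact b p);
  lact1 : forall p, lact 1 p = p;
  lactDl : forall (a b : A) p, lact (a + b) p = lact a p + lact b p;
  lactDr : forall a p q, lact a (p + q) = lact a p + lact a q;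
  ractA : forall (a b : A) p, ract p (a * b) = ract (ract p a) b;
  ract1 : forall p, ract p 1 = p;
  ractDl : forall a p q, ract (p + q) a = ract p a + ract q a;
  ractDr : forall (a b : A) p, ract p (a + b) = ract p a + ract p b;
  lractA : forall (a b : A) p, lact a (ract p b) = ract (lact a p) b;
  lact_scale : forall (c : k) p, lact (c *: (1 : A)) p = c *: p;
  ract_scale : forall (c : k) p, ract p (c *: (1 : A)) = c *: p
}.

Section TrivialExtension.
Variables (k : fieldType) (A : kalgebra k) (P : bimodule A).

Local Notation T := (A * P)%type.

Definition trivext_one : T := (1, 0).
Definition trivext_mul (x y : T) : T :=
  (x.1 * y.1, lact x.1 y.2 + ract x.2 y.1).

Lemma lact0r (a : A) : lact a (0 : P) = 0.
Proof. by apply: (addrI (lact a 0)); rewrite -lactDr !addr0. Qed.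
Lemma ract0l (a : A) : ract (0 : P) a = 0.
Proof. by apply: (addrI (ract 0 a)); rewrite -ractDl !addr0. Qed.
Lemma lactZl (c : k) (a : A) (p : P) : lact (c *: a) p = c *: lact a p.
Proof. by rewrite -[a in LHS]mul1r kscalerAl lactA lact_scale. Qed.
Lemma lactZr (c : k) (a : A) (p : P) : lact a (c *: p) = c *: lact a p.
Proof. by rewrite -lact_scale -lactA -kscalerAr mulr1 lactZl. Qed.
Lemma ractZr (c : k) (a : A) (p : P) : ract p (c *: a) = c *: ract p a.
Proof. by rewrite -[a in LHS]mulr1 kscalerAr ractA ract_scale. Qed.
Lemma ractZl (c : k) (a : A) (p : P) : ract (c *: p) a = c *: ract p a.
Proof. by rewrite -ract_scale -ractA -kscalerAl mul1r ractZr. Qed.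

Fact trivext_mulA : associative trivext_mul.
Proof.
move=> [a p] [b q] [c r]; rewrite /trivext_mul /=; congr (_, _).
  by rewrite mulrA.
by rewrite lactDr ractDl lactA ractA lractA addrA.
Qed.
Fact trivext_mul1 : left_id trivext_one trivext_mul.
Proof. by move=> [a p]; rewrite /trivext_mul /= mul1r lact1 ract0l addr0. Qed.
Fact trivext_mulr1 : right_id trivext_one trivext_mul.
Proof. by move=> [a p]; rewrite /trivext_mul /= mulr1 ract1 lact0r add0r. Qed.
Fact trivext_mulDl : left_distributive trivext_mul +%R.
Proof.
move=> [a p] [b q] [c r]; rewrite /trivext_mul /=; congr (_, _).
  by rewrite mulrDl.
by rewrite lactDl ractDl addrACA.
Qed.
Fact trivext_mulDr : right_distributive trivext_mul +%R.
Proof.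
move=> [a p] [b q] [c r]; rewrite /trivext_mul /=; congr (_, _).
  by rewrite mulrDr.
by rewrite lactDr ractDr addrACA.
Qed.
Fact trivext_scalerAl (c : k) x y :
  c *: trivext_mul x y = trivext_mul (c *: x) y.
Proof.
case: x y => [a p] [b q]; congr (_, _) => /=; first exact: kscalerAl.
by rewrite scalerDr lactZl ractZl.
Qed.
Fact trivext_scalerAr (c : k) x y :
  c *: trivext_mul x y = trivext_mul x (c *: y).
Proof.
case: x y => [a p] [b q]; congr (_, _) => /=; first exact: kscalerAr.
by rewrite scalerDr lactZr ractZr.
Qed.

Definition trivext : kalgebra k := KAlgebra
  trivext_mulA trivext_mul1 trivext_mulr1 trivext_mulDl trivext_mulDr
  trivext_scalerAl trivext_scalerAr.

Definition trivext_inl (a : A) : trivext := (a, 0).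

End TrivialExtension.

Section TensorBimodule.
Variables (k : fieldType) (A : kalgebra k) (e f : A).
Local Notation T := (tensor (lideal e) (rideal f)).

Definition tensor_lact (a : A) : {linear T -> T} :=
  tensor_map (lideal_mul a) idfun.
Definition tensor_ract (a : A) : {linear T -> T} :=
  tensor_map idfun (rideal_mul a).

Fact tensor_lactA a b p : tensor_lact (a * b) p = tensor_lact a (tensor_lact b p).
Proof.
apply: (@tensor_eq _ _ _ _ _ (tensor_lact a \o tensor_lact b)) => u v.
rewrite /= !tensor_mapE /=; congr tens.
by apply: val_inj; rewrite /= mulrA.
Qed.
Fact tensor_lact1 p : tensor_lact 1 p = p.
Proof.
apply: (@tensor_eq _ _ _ _ _ idfun) => u v; rewrite /= tensor_mapE /=.
by congr tens; apply: val_inj; rewrite /= mul1r.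
Qed.
Fact tensor_lactDl a b p :
  tensor_lact (a + b) p = tensor_lact a p + tensor_lact b p.
Proof.
apply: (@tensor_eq _ _ _ _ _ (tensor_lact a \+ tensor_lact b)) => u v.
rewrite /= !tensor_mapE /= -tensDl; congr tens.
by apply: val_inj; rewrite /= mulrDl.
Qed.
Fact tensor_lactDr a p q : tensor_lact a (p + q) = tensor_lact a p + tensor_lact a q.
Proof. exact: linearD. Qed.
Fact tensor_ractA a b p : tensor_ract (a * b) p = tensor_ract b (tensor_ract a p).
Proof.
apply: (@tensor_eq _ _ _ _ _ (tensor_ract b \o tensor_ract a)) => u v.
rewrite /= !tensor_mapE /=; congr tens.
by apply: val_inj; rewrite /= mulrA.
Qed.
Fact tensor_ract1 p : tensor_ract 1 p = p.
Proof.
apply: (@tensor_eq _ _ _ _ _ idfun) => u v; rewrite /= tensor_mapE /=.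
by congr tens; apply: val_inj; rewrite /= mulr1.
Qed.
Fact tensor_ractDl a p q : tensor_ract a (p + q) = tensor_ract a p + tensor_ract a q.
Proof. exact: linearD. Qed.
Fact tensor_ractDr a b p :
  tensor_ract (a + b) p = tensor_ract a p + tensor_ract b p.
Proof.
apply: (@tensor_eq _ _ _ _ _ (tensor_ract a \+ tensor_ract b)) => u v.
rewrite /= !tensor_mapE /= -tensDr; congr tens.
by apply: val_inj; rewrite /= mulrDr.
Qed.
Fact tensor_lractA a b p :
  tensor_lact a (tensor_ract b p) = tensor_ract b (tensor_lact a p).
Proof.
apply: (@tensor_eq _ _ _ _ (tensor_lact a \o tensor_ract b)
  (tensor_ract b \o tensor_lact a)) => u v.
by rewrite /= !tensor_mapE.
Qed.
Fact tensor_lact_scale c p : tensor_lact (c *: (1 : A)) p = c *: p.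
Proof.
apply: (@tensor_eq _ _ _ _ _ ( *:%R c)) => u v.
rewrite /= tensor_mapE /= -tensZl; congr tens.
by apply: val_inj; rewrite /= -kscalerAl mul1r.
Qed.
Fact tensor_ract_scale c p : tensor_ract (c *: (1 : A)) p = c *: p.
Proof.
apply: (@tensor_eq _ _ _ _ _ ( *:%R c)) => u v.
rewrite /= tensor_mapE /= -tensZr; congr tens.
by apply: val_inj; rewrite /= -kscalerAr mulr1.
Qed.

Definition tensor_bimodule : bimodule A :=
  @Bimodule k A T (fun a p => tensor_lact a p) (fun p a => tensor_ract a p)
    tensor_lactA tensor_lact1 tensor_lactDl tensor_lactDr
    tensor_ractA tensor_ract1 tensor_ractDl tensor_ractDr
    tensor_lractA tensor_lact_scale tensor_ract_scale.

End TensorBimodule.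

Section DirectSum.
Variables (k : fieldType) (I : finType) (M : I -> lmodType k).

Definition dsum : Type := {dffun forall i, M i}.
HB.instance Definition _ := Choice.on dsum.

Definition dsum_mk (g : forall i, M i) : dsum := [ffun i => g i].
Definition dsum_proj (x : dsum) (i : I) : M i :=
  (x : {dffun forall i, M i}) i.

Lemma dsumE g i : dsum_proj (dsum_mk g) i = g i.
Proof. exact: ffunE. Qed.
Lemma dsumP x y : (forall i, dsum_proj x i = dsum_proj y i) -> x = y.
Proof. by move=> xy; apply/ffunP. Qed.

Definition dsum_zero := dsum_mk (fun=> 0).
Definition dsum_opp x := dsum_mk (fun i => - dsum_proj x i).
Definition dsum_add x y := dsum_mk (fun i => dsum_proj x i + dsum_proj y i).
Definition dsum_scale (c : k) x := dsum_mk (fun i => c *: dsum_proj x i).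

Fact dsum_addA : associative dsum_add.
Proof. by move=> x y z; apply: dsumP => i; rewrite !dsumE addrA. Qed.
Fact dsum_addC : commutative dsum_add.
Proof. by move=> x y; apply: dsumP => i; rewrite !dsumE addrC. Qed.
Fact dsum_add0 : left_id dsum_zero dsum_add.
Proof. by move=> x; apply: dsumP => i; rewrite !dsumE add0r. Qed.
Fact dsum_addN : left_inverse dsum_zero dsum_opp dsum_add.
Proof. by move=> x; apply: dsumP => i; rewrite !dsumE addNr. Qed.
HB.instance Definition _ :=
  GRing.isZmodule.Build dsum dsum_addA dsum_addC dsum_add0 dsum_addN.

Lemma dsum_projD x y i : dsum_proj (x + y) i = dsum_proj x i + dsum_proj y i.
Proof. exact: dsumE. Qed.

Fact dsum_scaleA a b x : dsum_scale a (dsum_scale b x) = dsum_scale (a * b) x.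
Proof. by apply: dsumP => i; rewrite !dsumE scalerA. Qed.
Fact dsum_scale1 : left_id 1 dsum_scale.
Proof. by move=> x; apply: dsumP => i; rewrite !dsumE scale1r. Qed.
Fact dsum_scaleDr : right_distributive dsum_scale +%R.
Proof.
by move=> c x y; apply: dsumP => i; rewrite !(dsum_projD, dsumE) scalerDr.
Qed.
Fact dsum_scaleDl x : {morph dsum_scale^~ x : a b / a + b}.
Proof.
by move=> a b; apply: dsumP => i; rewrite !(dsum_projD, dsumE) scalerDl.
Qed.
HB.instance Definition _ := GRing.Zmodule_isLmodule.Build k dsum
  dsum_scaleA dsum_scale1 dsum_scaleDr dsum_scaleDl.

Lemma dsum_projZ c x i : dsum_proj (c *: x) i = c *: dsum_proj x i.
Proof. exact: dsumE. Qed.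

End DirectSum.

Section DirectSumBimodule.
Variables (k : fieldType) (A : kalgebra k).
Variables (I : finType) (M : I -> bimodule A).
Local Notation D := (dsum (fun i => bimodule_sort (M i))).

Definition dsum_lact (a : A) (x : D) : D :=
  dsum_mk (fun i => lact a (dsum_proj x i)).
Definition dsum_ract (x : D) (a : A) : D :=
  dsum_mk (fun i => ract (dsum_proj x i) a).

Let dE := (dsum_projD, dsum_projZ, dsumE).

Fact dsum_lactA a b p : dsum_lact (a * b) p = dsum_lact a (dsum_lact b p).
Proof. by apply: dsumP => i; rewrite !dsumE lactA. Qed.
Fact dsum_lact1 p : dsum_lact 1 p = p.
Proof. by apply: dsumP => i; rewrite !dsumE lact1. Qed.
Fact dsum_lactDl a b p : dsum_lact (a + b) p = dsum_lact a p + dsum_lact b p.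
Proof. by apply: dsumP => i; rewrite !(dsum_projD, dsumE) lactDl. Qed.
Fact dsum_lactDr a p q : dsum_lact a (p + q) = dsum_lact a p + dsum_lact a q.
Proof. by apply: dsumP => i; rewrite !(dsum_projD, dsumE) lactDr. Qed.
Fact dsum_ractA a b p : dsum_ract p (a * b) = dsum_ract (dsum_ract p a) b.
Proof. by apply: dsumP => i; rewrite !dsumE ractA. Qed.
Fact dsum_ract1 p : dsum_ract p 1 = p.
Proof. by apply: dsumP => i; rewrite !dsumE ract1. Qed.
Fact dsum_ractDl a p q : dsum_ract (p + q) a = dsum_ract p a + dsum_ract q a.
Proof. by apply: dsumP => i; rewrite !(dsum_projD, dsumE) ractDl. Qed.
Fact dsum_ractDr a b p : dsum_ract p (a + b) = dsum_ract p a + dsum_ract p b.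
Proof. by apply: dsumP => i; rewrite !(dsum_projD, dsumE) ractDr. Qed.
Fact dsum_lractA a b p :
  dsum_lact a (dsum_ract p b) = dsum_ract (dsum_lact a p) b.
Proof. by apply: dsumP => i; rewrite !dsumE lractA. Qed.
Fact dsum_lact_scale c p : dsum_lact (c *: (1 : A)) p = c *: p.
Proof. by apply: dsumP => i; rewrite dsum_projZ dsumE lact_scale. Qed.
Fact dsum_ract_scale c p : dsum_ract p (c *: (1 : A)) = c *: p.
Proof. by apply: dsumP => i; rewrite dsum_projZ dsumE ract_scale. Qed.

Definition dsum_bimodule : bimodule A :=
  @Bimodule k A D dsum_lact dsum_ract
    dsum_lactA dsum_lact1 dsum_lactDl dsum_lactDr
    dsum_ractA dsum_ract1 dsum_ractDl dsum_ractDr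
    dsum_lractA dsum_lact_scale dsum_ract_scale.

End DirectSumBimodule.

Record quiver := Quiver {
  vertex : finType;
  arrow : finType;
  src : arrow -> vertex;
  tgt : arrow -> vertex
}.

Section Paths.
Variable Q : quiver.

Fixpoint is_path (v : vertex Q) (s : seq (arrow Q)) : bool :=
  if s is a :: s' then (src a == v) && is_path (tgt a) s' else true.

Fixpoint path_end (v : vertex Q) (s : seq (arrow Q)) : vertex Q :=
  if s is a :: s' then path_end (tgt a) s' else v.

(* A path is its starting vertex with the list of its arrows from left to
   right; the vertex distinguishes the trivial paths. *)
Record qpath := QPath {
  qpath_val : vertex Q * seq (arrow Q);
  qpathP : is_path qpath_val.1 qpath_val.2
}.
HB.instance Definition _ := [isSub for qpath_val].
HB.instance Definition _ := [Choice of qpath by <:].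

Definition pstart (p : qpath) : vertex Q := (val p).1.
Definition parrows (p : qpath) : seq (arrow Q) := (val p).2.
Definition pend (p : qpath) : vertex Q := path_end (pstart p) (parrows p).

Lemma is_path_cat v s s' :
  is_path v (s ++ s') = is_path v s && is_path (path_end v s) s'.
Proof. by elim: s v => //= a s IHs v; rewrite IHs andbA. Qed.
Lemma path_end_cat v s s' : path_end v (s ++ s') = path_end (path_end v s) s'.
Proof. by elim: s v => //=. Qed.

Definition trivial_path (v : vertex Q) : qpath :=
  @QPath (v, [::]) isT.

Fact arrow_path_subproof (a : arrow Q) : is_path (src a) [:: a].
Proof. by rewrite /= eqxx. Qed.
Definition arrow_path (a : arrow Q) : qpath :=
  @QPath (src a, [:: a]) (arrow_path_subproof a).

Definition path_comp : qpath -> qpath -> option qpath :=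
  locked_with lock_key (fun p q =>
    if pend p == pstart q then insub (pstart p, parrows p ++ parrows q)
    else None).

Variant path_comp_spec p q : option qpath -> Prop :=
| PathComp r of pend p = pstart q & pstart r = pstart p &
    parrows r = parrows p ++ parrows q & pend r = pend q :
    path_comp_spec p q (Some r)
| PathNoComp of pend p <> pstart q : path_comp_spec p q None.

Lemma path_compP p q : path_comp_spec p q (path_comp p q).
Proof.
rewrite /path_comp locked_withE; case: eqP => [pq|]; last by constructor.
have Ppq : is_path (pstart p, parrows p ++ parrows q).1
                   (pstart p, parrows p ++ parrows q).2.
  rewrite /= is_path_cat; apply/andP; split; first exact: (qpathP p).
  by rewrite -/(pend p) pq; exact: (qpathP q).
rewrite (insubT (fun x : vertex Q * seq (arrow Q) => is_path x.1 x.2) Ppq).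
constructor=> //; rewrite /pend /pstart /parrows /= path_end_cat.
by rewrite -/(pstart p) -/(parrows p) -/(pend p) pq.
Qed.

Lemma qpath_eq p q : pstart p = pstart q -> parrows p = parrows q -> p = q.
Proof.
case: p q => [[v s] ps] [[w s'] qs]; rewrite /pstart /parrows /= => vw ss'.
by apply: val_inj; rewrite /= vw ss'.
Qed.

End Paths.

Section PathAlgebra.
Variables (k : fieldType) (Q : quiver).

Local Notation kQ := {malg k[qpath Q]}.

Definition pelt : qpath Q -> kQ := locked_with lock_key (fun p => << p >>).

Lemma peltE p : pelt p = << p >>.
Proof. by rewrite /pelt locked_withE. Qed.

Definition path_mul2 : qpath Q -> qpath Q -> kQ := locked_with lock_key
  (fun p q => if path_comp p q is Some r then pelt r else 0).

Lemma path_mul2E p q :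
  path_mul2 p q = if path_comp p q is Some r then pelt r else 0.
Proof. by rewrite /path_mul2 locked_withE. Qed.

Definition path_mul : kQ -> kQ -> kQ :=
  locked_with lock_key (fun x y => lin_ext (fun p => lin_ext (path_mul2 p) y) x).

Lemma path_mul_def x y :
  path_mul x y = lin_ext (fun p => lin_ext (path_mul2 p) y) x.
Proof. by rewrite /path_mul locked_withE. Qed.

Definition path_one : kQ := \sum_(v : vertex Q) pelt (trivial_path v).

Definition path_mulr (y x : kQ) : kQ := path_mul x y.
Fact path_mul_is_linear x : linear (path_mul x).
Proof.
move=> c y z; rewrite !path_mul_def !lin_extE scaler_sumr -big_split /=.
apply: eq_bigr => p _.
by rewrite linearP scalerDr !scalerA mulrC.
Qed.
Fact path_mulr_is_linear y : linear (path_mulr y).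
Proof. by move=> c x z; rewrite /path_mulr !path_mul_def linearP. Qed.
HB.instance Definition _ x := GRing.isLinear.Build k kQ kQ *:%R
  (path_mul x) (path_mul_is_linear x).
HB.instance Definition _ y := GRing.isLinear.Build k kQ kQ *:%R
  (path_mulr y) (path_mulr_is_linear y).

Lemma pelt_ext (V : lmodType k) (F G : {linear kQ -> V}) :
  (forall p, F (pelt p) = G (pelt p)) -> F =1 G.
Proof. by move=> FG; apply: lin_ext_eq => p; rewrite -peltE FG. Qed.

Lemma path_mulE p q : path_mul (pelt p) (pelt q) = path_mul2 p q.
Proof. by rewrite path_mul_def !peltE !lin_extU !scale1r. Qed.

Lemma path_mul0r x : path_mul 0 x = 0.
Proof. exact: (linear0 (path_mulr x)). Qed.
Lemma path_mulr0 x : path_mul x 0 = 0.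
Proof. exact: (linear0 (path_mul x)). Qed.

Fact path_mulA : associative path_mul.
Proof.
move=> x y z.
apply: (pelt_ext (F := path_mulr (path_mul y z))
  (G := path_mulr z \o path_mulr y)) => p /=.
apply: (pelt_ext (F := path_mul (pelt p) \o path_mulr z)
  (G := path_mulr z \o path_mul (pelt p))) => q /=.
apply: (pelt_ext (F := path_mul (pelt p) \o path_mul (pelt q))
  (G := path_mul (path_mul (pelt p) (pelt q)))) => r /=.
rewrite !path_mulE !path_mul2E.
case: (path_compP q r) => [s qr s1 s2 s3|qr]; case: (path_compP p q) => [u pq u1 u2 u3|pq].
- rewrite !path_mulE !path_mul2E.
  case: path_compP => [w _ w1 w2 _|[]]; last by rewrite s1.
  case: path_compP => [w' _ w1' w2' _|[]]; last by rewrite u3.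
  congr pelt; apply: qpath_eq; first by rewrite w1 w1' u1.
  by rewrite w2 w2' u2 s2 catA.
- rewrite path_mulE path_mul2E path_mul0r.
  by case: path_compP => [w ps|//]; case: pq; rewrite ps s1.
- rewrite path_mulE path_mul2E path_mulr0.
  by case: path_compP => [w ps|//]; case: qr; rewrite -u3.
- by rewrite path_mul0r path_mulr0.
Qed.

Fact path_mul1 : left_id path_one path_mul.
Proof.
move=> x; apply: (pelt_ext (F := path_mul path_one) (G := idfun)) => p /=.
rewrite -[LHS]/(path_mulr _ _) linear_sum (bigD1 (pstart p)) //= big1 ?addr0.
  rewrite /path_mulr path_mulE !path_mul2E.
  case: path_compP => [w _ w1 w2 _|//].
  by congr pelt; apply: qpath_eq.
move=> v vp; rewrite /path_mulr path_mulE !path_mul2E.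
by case: path_compP => // w pv; case/eqP: vp.
Qed.

Fact path_mulr1 : right_id path_one path_mul.
Proof.
move=> x; apply: (pelt_ext (F := path_mulr path_one) (G := idfun)) => p /=.
rewrite /path_mulr linear_sum (bigD1 (pend p)) //= big1 ?addr0.
  rewrite path_mulE !path_mul2E.
  case: path_compP => [w _ w1 w2 _|//].
  by congr pelt; apply: qpath_eq => //; rewrite w2 cats0.
move=> v vp; rewrite path_mulE !path_mul2E.
by case: path_compP => // w pv; case/eqP: vp; rewrite pv.
Qed.

Fact path_mulDl : left_distributive path_mul +%R.
Proof. by move=> x y z; exact: (linearD (path_mulr z)). Qed.
Fact path_mulDr : right_distributive path_mul +%R.
Proof. by move=> x y z; exact: (linearD (path_mul x)). Qed.

Fact path_scalerAl (c : k) x y : c *: path_mul x y = path_mul (c *: x) y.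
Proof. by rewrite -[RHS]/(path_mulr _ _) linearZ_LR. Qed.
Fact path_scalerAr (c : k) x y : c *: path_mul x y = path_mul x (c *: y).
Proof. by rewrite linearZ_LR. Qed.

Definition path_alg : kalgebra k := KAlgebra
  path_mulA path_mul1 path_mulr1 path_mulDl path_mulDr
  path_scalerAl path_scalerAr.

Definition path_elt (p : qpath Q) : path_alg := pelt p.
Definition path_coef (x : path_alg) (p : qpath Q) : k := (x : kQ)@_p.

Definition vertex_elt (v : vertex Q) : path_alg := path_elt (trivial_path v).
Definition arrow_elt (a : arrow Q) : path_alg := path_elt (arrow_path a).

Definition arrow_ideal : ideal path_alg := ideal_gen (range arrow_elt).

Definition admissible (I : ideal path_alg) : Prop :=
  exists m : nat, [/\ (2 <= m)%N, ideal_exp arrow_ideal m `<=` I &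
                      I `<=` ideal_exp arrow_ideal 2].

Definition arrow_occurs (a : arrow Q) (x : path_alg) : Prop :=
  exists p : qpath Q, path_coef x p != 0 /\ a \in parrows p.

Definition quot_vertex (I : ideal path_alg) (v : vertex Q) : quot_alg I :=
  quot_alg_pi I (vertex_elt v).

End PathAlgebra.

Arguments vertex_elt k {Q} v.
Arguments arrow_elt k {Q} a.
Arguments arrow_ideal k Q : clear implicits.

Section AddArrows.
Variables (Q : quiver) (t : nat) (e f : 'I_t -> vertex Q).

Definition add_arrows : quiver :=
  @Quiver (vertex Q) (arrow Q + 'I_t)%type
    (fun b => match b with inl a => src a | inr i => e i end)
    (fun b => match b with inl a => tgt a | inr i => f i end).

Definition new_arrow (i : 'I_t) : arrow add_arrows := inr i.

Fact incl_path_subproof (p : qpath Q) :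
  @is_path add_arrows (pstart p) (map inl (parrows p)).
Proof.
rewrite /pstart /parrows; case: p => [[v s] /=].
by elim: s v => //= a s IHs v /andP[-> /IHs].
Qed.
Definition incl_path (p : qpath Q) : qpath add_arrows :=
  @QPath add_arrows (pstart p, map inl (parrows p)) (incl_path_subproof p).

Variable k : fieldType.

Definition incl_alg (x : path_alg k Q) : path_alg k add_arrows :=
  lin_ext (fun p => path_elt k (incl_path p)) x.

Definition ext_ideal (I : ideal (path_alg k Q)) : ideal (path_alg k add_arrows) :=
  ideal_gen (incl_alg @` I).

Definition proj_bimodule (I : ideal (path_alg k Q)) : bimodule (quot_alg I) :=
  dsum_bimodule (fun i : 'I_t =>
    tensor_bimodule (quot_vertex I (e i)) (quot_vertex I (f i))).

End AddArrows.

(* Main.v *)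
From HB Require Import structures.
Require Import Defs.
From mathcomp Require Import all_boot all_algebra.
From mathcomp Require Import boolp classical_sets.
From mathcomp.multinomials Require Import monalg.

Set Implicit Arguments.
Unset Strict Implicit.
Unset Printing Implicit Defensive.

Import GRing.Theory.
Local Open Scope ring_scope.
Local Open Scope classical_set_scope.

(** For idempotents, [Hom (e Gamma, f Gamma) = f Gamma e], so the hypothesis says
    [f_j Gamma e_i = 0] for all [i], [j].
    Send the paths without new arrow to [Gamma] and the new arrow [a_i] to
    [e_i (x) f_i]: this map [kQ -> Gamma |x P] kills [<I^*>].  In the other direction
    send [gamma] to its class and [x (x) y] in the [i]-th summand to [x a_i y]; this
    is multiplicative because [P P = 0] in the trivial extension, while
    [(x a_i y) (x' a_j y')] vanishes as [y x'] lies in [f_i Gamma e_j = 0].  The two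
    maps are mutually inverse, since both composites fix generators.
    Admissibility only serves to make [I^*] finitely generated: a finite generating
    set of [I^*] also generates [<I^*>], and a generating subset of least size
    is minimal and involves no new arrow.
    Finally [f_j Lambda e_i = 0] because [f_j P] is a sum of tensor products
    [f_j Gamma e_l (x) f_l Gamma = 0]. *)

(** * Cyclic one-sided ideals and the homomorphisms between them *)

Section OneSidedGenerators.
Variables (k : fieldType) (A : kalgebra k) (e : A).

Fact lideal_gen_subproof : e \in lideal_pred e.
Proof. by apply/asboolP; exists 1; rewrite mul1r. Qed.
Definition lideal_gen : lideal e := Lideal lideal_gen_subproof.

Fact rideal_gen_subproof : e \in rideal_pred e.
Proof. by apply/asboolP; exists 1; rewrite mulr1. Qed.
Definition rideal_gen : rideal e := Rideal rideal_gen_subproof.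

Hypothesis ee : e * e = e.

Lemma lideal_mul_gen (x : lideal e) : lideal_mul (val x) lideal_gen = x.
Proof. by apply: val_inj; case: x => x /= /asboolP[y ->]; rewrite -mulrA ee. Qed.

Lemma rideal_mul_gen (x : rideal e) : rideal_mul (val x) rideal_gen = x.
Proof. by apply: val_inj; case: x => x /= /asboolP[y ->]; rewrite mulrA ee. Qed.

End OneSidedGenerators.

Section HomZero.
Variables (k : fieldType) (A : kalgebra k) (e f : A).
Hypothesis ee : e * e = e.

Let rmod_gen : rmod e := rideal_gen e.

Fact rmod_lmul_subproof (x : A) (y : rmod e) :
  f * x * val (y : rideal e) \in rideal_pred f.
Proof. by apply/asboolP; exists (x * val (y : rideal e)); rewrite mulrA. Qed.
Definition rmod_lmul (x : A) (y : rmod e) : rmod f :=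
  Rideal (rmod_lmul_subproof x y).

Fact rmod_lmul_is_linear x : linear (rmod_lmul x).
Proof.
move=> c y z; apply: val_inj => /=.
by rewrite mulrDr mulrA.
Qed.
HB.instance Definition _ x := GRing.isLinear.Build A^c (rmod e) (rmod f) *:%R
  (rmod_lmul x) (rmod_lmul_is_linear x).

(** A homomorphism is determined by its value at the generator [e], and since [e = e * e] this value
    lies in [f A e]. Conversely, left multiplication by [f * x] sends [e] to [f * x * e]. *)
Lemma Hom_zeroP : Hom_zero e f <-> forall x, f * x * e = 0.
Proof.
split=> [H0 x|fe0 h x].
  have /(congr1 (fun y : rmod f => val (y : rideal f))) := H0 (rmod_lmul x) rmod_gen.
  by [].
have gen_e : rmod_gen = (e : A^c) *: rmod_gen by apply: val_inj; rewrite /= ee.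
have hgen : h rmod_gen = 0.
  apply: val_inj; rewrite gen_e linearZ /=.
  by case: (h rmod_gen) => y /= /asboolP[z ->]; rewrite fe0.
have -> : x = (val (x : rideal e) : A^c) *: rmod_gen.
  exact: esym (rideal_mul_gen ee (x : rideal e)).
by rewrite linearZ /= hgen scaler0.
Qed.

End HomZero.

(** * Induction on tensors, morphisms out of quotients, preimages of ideals *)

Section TensorInd.
Variables (k : fieldType) (U V : lmodType k).

(** Scalars are absorbed into the left factor, so pure tensors span additively. *)
Lemma tensor_ind (P : tensor U V -> Prop) : P 0 ->
  (forall x y, P x -> P y -> P (x + y)) -> (forall u v, P (tens u v)) ->
  forall z, P z.
Proof.
move=> P0 PD Pt; elim/quot_ind => x.
rewrite -[quot_pi _ x]/(tensor_pi x) [x]monalgE linear_sum.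
apply: (big_ind P) => // -[u v] _.
by rewrite malgU_scale linearZ_LR /= -[X in _ *: X]tensE -tensZl.
Qed.

End TensorInd.

Section QuotAlgLift.
Variables (k : fieldType) (A B : kalgebra k) (I : ideal A).
Variable F : {linear A -> B}.
Hypothesis FI : forall x, I x -> F x = 0.

(** The proof that [F] kills [I] is an argument, so that the linear structure registered below can
    be inferred from the term itself. *)
Definition quot_alg_lift of (forall x, I x -> F x = 0) : quot_alg I -> B :=
  quot_lift F.

Fact quot_alg_lift_is_linear : linear (quot_alg_lift FI).
Proof. exact: (@quot_lift_is_linear _ _ (ideal_submodule I) _ F FI). Qed.

Lemma quot_alg_liftE x : quot_alg_lift FI (quot_alg_pi I x) = F x.
Proof. exact: (@quot_liftE _ _ (ideal_submodule I) _ F FI). Qed.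

Lemma quot_alg_lift_monoid_morphism :
  monoid_morphism F -> monoid_morphism (quot_alg_lift FI).
Proof.
move=> [F1 FM]; split; first by rewrite -F1 -quot_alg_liftE rmorph1.
elim/quot_alg_ind=> x; elim/quot_alg_ind=> y.
by rewrite -rmorphM !quot_alg_liftE.
Qed.

End QuotAlgLift.
HB.instance Definition _ (k : fieldType) (A B : kalgebra k) I F FI :=
  GRing.isLinear.Build k (quot_alg I) B *:%R (@quot_alg_lift k A B I F FI)
  (@quot_alg_lift_is_linear k A B I F FI).

Section PreimageIdeal.
Variables (k : fieldType) (A B : kalgebra k) (F : {linear A -> B}).
Hypothesis FM : monoid_morphism F.
Variable U : ideal B.

Fact preim_ideal0 : (F @^-1` U) 0.
Proof. by rewrite /preimage /= linear0; apply: ideal0. Qed.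
Fact preim_idealD x y : (F @^-1` U) x -> (F @^-1` U) y ->
  (F @^-1` U) (x + y).
Proof. by rewrite /preimage /= linearD; apply: idealD. Qed.
Fact preim_idealMl a x : (F @^-1` U) x -> (F @^-1` U) (a * x).
Proof. by rewrite /preimage /= FM.2; apply: idealMl. Qed.
Fact preim_idealMr a x : (F @^-1` U) x -> (F @^-1` U) (x * a).
Proof. by rewrite /preimage /= FM.2; apply: Defs.idealMr. Qed.

Definition preim_ideal : ideal A :=
  Ideal preim_ideal0 preim_idealD preim_idealMl preim_idealMr.

End PreimageIdeal.

Section ZeroIdeal.
Variables (k : fieldType) (A : kalgebra k).

Fact zero_idealD (x y : A) : [set 0] x -> [set 0] y ->
  [set 0 : A] (x + y).
Proof. by move=> -> ->; rewrite /= addr0. Qed.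
Fact zero_idealMl (a x : A) : [set 0] x -> [set 0 : A] (a * x).
Proof. by move=> ->; rewrite /= mulr0. Qed.
Fact zero_idealMr (a x : A) : [set 0] x -> [set 0 : A] (x * a).
Proof. by move=> ->; rewrite /= mul0r. Qed.

Definition zero_ideal : ideal A :=
  Ideal (erefl 0) zero_idealD zero_idealMl zero_idealMr.

End ZeroIdeal.

(** The kernel of an algebra morphism is the preimage of the zero ideal, hence an ideal; once it
    contains [S] it contains [ideal_gen S]. *)
Lemma ideal_gen_eq0 (k : fieldType) (A B : kalgebra k) (F : {linear A -> B})
    (S : set A) : monoid_morphism F -> (forall x, S x -> F x = 0) ->
  forall x, ideal_gen S x -> F x = 0.
Proof. by move=> FM S0 x /(_ (preim_ideal FM (zero_ideal B))); apply. Qed.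

(** * Algebra morphisms out of a path algebra *)

Section PathMorphism.
Variables (k : fieldType) (Q : quiver) (B : kalgebra k).

Lemma path_elt_ext (F G : {linear path_alg k Q -> B}) :
  (forall p, F (path_elt k p) = G (path_elt k p)) -> F =1 G.
Proof. exact: pelt_ext. Qed.

Lemma path_elt_mul (p q : qpath Q) : path_elt k p * path_elt k q =
  if path_comp p q is Some r then path_elt k r else 0.
Proof.
have := path_mulE k p q; rewrite path_mul2E => H.
by apply: (etrans H); case: path_comp.
Qed.

Variable g : qpath Q -> B.
Definition path_lin_ext (x : path_alg k Q) : B := lin_ext g x.

Fact path_lin_ext_is_linear : linear path_lin_ext.
Proof. exact: lin_ext_is_linear. Qed.
HB.instance Definition _ := GRing.isLinear.Build k (path_alg k Q) B *:%R
  path_lin_ext path_lin_ext_is_linear.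

Lemma path_lin_extE p : path_lin_ext (path_elt k p) = g p.
Proof. by rewrite /path_lin_ext /path_elt peltE lin_extU scale1r. Qed.

Lemma path_lin_extZ c x : path_lin_ext (c *: x) = c *: path_lin_ext x.
Proof. exact: linearZ_LR. Qed.

Lemma path_sum_ind (P : path_alg k Q -> Prop) : P 0 ->
  (forall x y, P x -> P y -> P (x + y)) -> (forall c p, P (c *: path_elt k p)) ->
  forall z, P z.
Proof.
move=> P0 PD Pt z; rewrite [z]monalgE.
by apply: (big_ind P) => // p _; rewrite malgU_scale -peltE; apply: Pt.
Qed.

(** Both sides of multiplicativity are bilinear, so paths suffice; the unit is the sum of the
    trivial paths. *)
Lemma path_lin_ext_monoid_morphism :
  (forall p q, g p * g q = if path_comp p q is Some r then g r else 0) ->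
  \sum_(v : vertex Q) g (trivial_path v) = 1 -> monoid_morphism path_lin_ext.
Proof.
move=> gM g1; split.
  rewrite -g1 -[1]/(\sum_v vertex_elt k v) linear_sum.
  by apply: eq_bigr => v _; apply: path_lin_extE.
elim/path_sum_ind => [|x x' Hx Hx'|c p] y; first by rewrite mul0r linear0 mul0r.
  by rewrite mulrDl !linearD /= mulrDl Hx Hx'.
suff pM : path_lin_ext (path_elt k p * y) =
    path_lin_ext (path_elt k p) * path_lin_ext y.
  rewrite -kscalerAl; apply: etrans (path_lin_extZ _ _) _.
  rewrite pM kscalerAl; congr (_ * _); apply/esym; exact: path_lin_extZ.
elim/path_sum_ind: y => [|x x' Hx Hx'|d q]; first by rewrite mulr0 linear0 mulr0.
  by rewrite mulrDr !linearD /= mulrDr Hx Hx'.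
suff qM : path_lin_ext (path_elt k p * path_elt k q) =
    path_lin_ext (path_elt k p) * path_lin_ext (path_elt k q).
  rewrite -kscalerAr; apply: etrans (path_lin_extZ _ _) _.
  rewrite qM kscalerAr; congr (_ * _); apply/esym; exact: path_lin_extZ.
rewrite path_elt_mul !path_lin_extE gM.
by case: path_comp => [r|]; rewrite ?path_lin_extE ?linear0.
Qed.

End PathMorphism.

Section PathAlgebraTheory.
Variables (k : fieldType) (Q : quiver).

(** Peeling off the first arrow drives the inductions on path length. *)
Lemma path_elt_cons (p : qpath Q) a s : parrows p = a :: s ->
  exists2 q : qpath Q, parrows q = s & path_elt k p = arrow_elt k a * path_elt k q.
Proof.
move=> ps; have := qpathP p; rewrite -/(parrows p) -/(pstart p) ps /=.
case/andP=> /eqP srca qs; exists (@QPath Q (tgt a, s) qs) => //.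
rewrite /arrow_elt path_elt_mul; case: path_compP => [r _ r1 r2 _|[]] //.
by congr path_elt; apply: qpath_eq; [rewrite r1 | rewrite r2 ps].
Qed.

Lemma path_elt_vertex (p : qpath Q) : parrows p = [::] ->
  path_elt k p = vertex_elt k (pstart p).
Proof. by move=> ps; congr path_elt; apply: qpath_eq. Qed.

Lemma vertex_elt_mul (v w : vertex Q) :
  vertex_elt k v * vertex_elt k w = if v == w then vertex_elt k v else 0.
Proof.
rewrite /vertex_elt path_elt_mul; case: path_compP => [r vw r1 r2 _|/eqP vw].
  by move/eqP: vw => /= ->; congr path_elt; apply: qpath_eq.
by rewrite ifN.
Qed.

Lemma vertex_arrow_elt (a : arrow Q) :
  vertex_elt k (src a) * arrow_elt k a = arrow_elt k a.
Proof.
rewrite /vertex_elt path_elt_mul; case: path_compP => [r _ r1 r2 _|[]] //.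
by congr path_elt; apply: qpath_eq.
Qed.

Lemma arrow_vertex_elt (a : arrow Q) :
  arrow_elt k a * vertex_elt k (tgt a) = arrow_elt k a.
Proof.
rewrite /vertex_elt path_elt_mul; case: path_compP => [r _ r1 r2 _|[]] //.
by congr path_elt; apply: qpath_eq.
Qed.

Variable B : kalgebra k.

Lemma path_alg_morphism_eq (F G : {linear path_alg k Q -> B}) :
  monoid_morphism F -> monoid_morphism G ->
  (forall v, F (vertex_elt k v) = G (vertex_elt k v)) ->
  (forall a, F (arrow_elt k a) = G (arrow_elt k a)) -> F =1 G.
Proof.
move=> [_ FM] [_ GM] FGv FGa; apply: path_elt_ext => p.
have [s ps] : exists s, parrows p = s by exists (parrows p).
elim: s p ps => [|a s IHs] p ps; first by rewrite (path_elt_vertex ps).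
have [q qs ->] := path_elt_cons ps.
by rewrite FM GM FGa (IHs q).
Qed.

Variables (u : vertex Q -> B) (w : arrow Q -> B).
Hypothesis u_mul : forall v v', u v * u v' = if v == v' then u v else 0.
Hypothesis u_sum : \sum_v u v = 1.
Hypothesis uw : forall a, u (src a) * w a = w a.
Hypothesis wu : forall a, w a * u (tgt a) = w a.

(** The value of [p] under the morphism prescribed by [u] on vertices and [w] on arrows. The leading
    factor makes a trivial path go to its idempotent instead of the empty product [1]. *)
Definition path_value (p : qpath Q) : B :=
  u (pstart p) * \prod_(a <- parrows p) w a.

Let value_end v s : is_path v s ->
  u v * (\prod_(a <- s) w a) * u (path_end v s) = u v * \prod_(a <- s) w a.
Proof.
elim: s v => [|a s IHs] v /=; first by rewrite big_nil mulr1 u_mul eqxx.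
(* Writing [w a] as [w a * u (tgt a)] gives the tail the leading idempotent that the induction
   hypothesis asks for. *)
case/andP=> _ /IHs; rewrite big_cons -(wu a) -!mulrA => ->.
by [].
Qed.

(** The idempotent of the end of [p] can be inserted at the junction, where it meets that of the
    start of [q]; orthogonality kills the product unless the two vertices agree. *)
Let path_value_mul p q : path_value p * path_value q =
  if path_comp p q is Some r then path_value r else 0.
Proof.
have pE : path_value p * u (pend p) = path_value p.
  exact: value_end (qpathP p).
rewrite -pE /path_value -mulrA [u (pend p) * _]mulrA u_mul.
case: path_compP => [r pq r1 r2 _|/eqP pq]; last by rewrite ifN // mul0r mulr0.
by rewrite pq eqxx -pq mulrA [_ * u (pend p)]pE /path_value r1 r2 big_cat mulrA.
Qed.

Lemma path_value_monoid_morphism : monoid_morphism (path_lin_ext path_value).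
Proof.
apply: path_lin_ext_monoid_morphism => //.
by rewrite -u_sum; apply: eq_bigr => v _; rewrite /path_value big_nil mulr1.
Qed.

Lemma path_value_vertex v : path_lin_ext path_value (vertex_elt k v) = u v.
Proof. by rewrite path_lin_extE /path_value big_nil mulr1. Qed.

Lemma path_value_arrow a : path_lin_ext path_value (arrow_elt k a) = w a.
Proof. by rewrite path_lin_extE /path_value /= big_seq1 uw. Qed.

End PathAlgebraTheory.

(** * The inclusion of path algebras when arrows are added *)

Section Inclusion.
Variables (k : fieldType) (Q : quiver) (t : nat) (e f : 'I_t -> vertex Q).
Local Notation incl := (incl_alg e f (k := k)).

(* [incl_alg], which has no linear structure in scope. *)
Definition incl_lin : path_alg k Q -> path_alg k (add_arrows e f) :=
  path_lin_ext (fun p => path_elt k (incl_path e f p)).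
HB.instance Definition _ := GRing.Linear.on incl_lin.

Lemma incl_algE x : incl x = incl_lin x.
Proof. by []. Qed.

Lemma incl_path_elt p : incl_lin (path_elt k p) = path_elt k (incl_path e f p).
Proof. exact: path_lin_extE. Qed.

Lemma path_end_incl v (s : seq (arrow Q)) :
  @path_end (add_arrows e f) v (map inl s) = @path_end Q v s.
Proof. by elim: s v => //=. Qed.

(** Old paths keep their endpoints, so two of them compose in [add_arrows e f] exactly when they
    compose in [Q]; the vertices are the same, so the unit is preserved. *)
Lemma incl_lin_monoid_morphism : monoid_morphism incl_lin.
Proof.
apply: path_lin_ext_monoid_morphism => [p q|].
  rewrite path_elt_mul.
  have pend_incl : pend (incl_path e f p) = pend p := path_end_incl _ _.
  case: path_compP => [r pq r1 r2 _|pq]; case: path_compP => [r' pq' r1' r2' _|pq'] //.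
  - congr path_elt; apply: qpath_eq; first by rewrite r1; exact: (esym r1').
    rewrite r2 -[parrows _ ++ _]map_cat; congr map; exact: (esym r2').
  - by case: pq'; rewrite -pend_incl pq.
  - by case: pq; rewrite pend_incl pq'.
rewrite -[1]/(\sum_v @vertex_elt k (add_arrows e f) v).
by apply: eq_bigr => v _; congr path_elt; apply: qpath_eq.
Qed.

Lemma incl_vertex v : incl_lin (vertex_elt k v) = @vertex_elt k (add_arrows e f) v.
Proof.
by rewrite incl_path_elt; congr path_elt; apply: qpath_eq.
Qed.

Lemma incl_arrow a :
  incl_lin (arrow_elt k a) = @arrow_elt k (add_arrows e f) (inl a).
Proof.
by rewrite incl_path_elt; congr path_elt; apply: qpath_eq.
Qed.

End Inclusion.

(** * Finite-dimensional subspaces *)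

Section FiniteSpan.
Variables (k : fieldType) (V : lmodType k).

(** The linear span of [s], with coefficients chosen one at a time to suit induction on [s]. *)
Fixpoint finite_span (s : seq V) (x : V) : Prop :=
  if s is b :: s' then exists c : k, finite_span s' (x - c *: b) else x = 0.

Lemma finite_span0 s : finite_span s 0.
Proof. by elim: s => //= b s IHs; exists 0; rewrite scale0r subr0. Qed.

Lemma finite_spanP s c x y :
  finite_span s x -> finite_span s y -> finite_span s (c *: x + y).
Proof.
elim: s x y => [|b s IHs] x y /=; first by move=> -> ->; rewrite scaler0 addr0.
move=> [d sx] [d' sy]; exists (c * d + d').
have -> : c *: x + y - (c * d + d') *: b = c *: (x - d *: b) + (y - d' *: b).
  by rewrite scalerBr scalerDl scalerA opprD addrACA.
exact: IHs.
Qed.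

Lemma mem_finite_span s b : b \in s -> finite_span s b.
Proof.
elim: s => //= b' s IHs; rewrite inE => /predU1P[->|/IHs sb].
  by exists 1; rewrite scale1r subrr; apply: finite_span0.
by exists 0; rewrite scale0r subr0.
Qed.

Lemma finite_span_sub (W : submodule V) s x :
  (forall b, b \in s -> W b) -> finite_span s x -> W x.
Proof.
elim: s x => [|b s IHs] x sW /=; first by move->; apply: submodule0.
case=> c /IHs xW; rewrite -[x](subrK (c *: b)) addrC.
apply: submoduleP; first by apply: sW; rewrite mem_head.
by apply: xW => b' sb'; apply: sW; rewrite inE sb' orbT.
Qed.

(** Gaussian elimination: each vector of [s] contributes at most one element to [L]. *)
Lemma finite_span_submodule (W : submodule V) (s : seq V) :
  exists L : seq V, (forall x, x \in L -> W x) /\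
    forall x, W x -> finite_span s x -> finite_span L x.
Proof.
elim: s => [|b s [L [LW sL]]]; first by exists [::].
(* If some [w] in [W] has coefficient [1] at [b], it eliminates [b]; otherwise
   every element of [W] has coefficient [0] there. *)
have [[w [Ww sw]]|nw] := pselect (exists w, W w /\ finite_span s (w - b)).
  exists (w :: L); split=> [x|x Wx [c sx]].
    by rewrite inE => /predU1P[->|/LW].
  exists c; apply: sL.
    by rewrite addrC -scaleNr; exact: submoduleP Ww Wx.
  have -> : x - c *: w = (- c) *: (w - b) + (x - c *: b).
    by rewrite scaleNr scalerBr opprB [RHS]addrC addrA subrK.
  exact: finite_spanP.
exists L; split=> // x Wx [c sx].
have [c0|c0] := eqVneq c 0.
  by apply: sL => //; rewrite c0 scale0r subr0 in sx.
(* Dividing [x] by its coefficient [c] would give an element of [W] with coefficient [1] at [b]. *)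
case: nw; exists (c^-1 *: x); split; first exact: submoduleZ.
rewrite -[b]scale1r -(mulVf c0) -scalerA -scalerBr -[_ *: _]addr0.
by apply: finite_spanP => //; apply: finite_span0.
Qed.

End FiniteSpan.

(** * Minimal generating sets of ideals *)

Section MinimalGenerators.
Variables (k : fieldType) (A : kalgebra k).

Lemma ideal_gen_sub (S : set A) (U : ideal A) : S `<=` U -> ideal_gen S `<=` U.
Proof. by move=> SU x; apply. Qed.

Lemma sub_ideal_gen (S : set A) : S `<=` ideal_gen S.
Proof. by move=> x Sx U; apply. Qed.

Lemma finite_minimal_generating_set (I : ideal A) (s : seq A) :
  ideal_gen [set` s] = I :> set A ->
  exists2 S, S `<=` [set` s] & minimal_generating_set I S.
Proof.
move=> sI; pose P n := `[< exists2 s' : seq A, size s' = n &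
  [set` s'] `<=` [set` s] /\ ideal_gen [set` s'] = I :> set A >].
have exP : exists n, P n
  by exists (size s); apply/asboolP; exists s => //; split=> //; apply: subset_refl.
case: (ex_minnP exP) => n /asboolP[s' s'n [s's s'I]] nmin.
exists [set` s'] => //; split=> // S' S's' S'I.
apply/seteqP; split=> // x s'x; apply: contrapT => S'x.
(* [S'] is listed by filtering [s']. As [x] is lost, the filtered list is shorter than [s'], against
   the minimality of [n]. *)
have S'E : [set` [seq y <- s' | `[< S' y >]]] = S'.
  apply/seteqP; split=> [y|y S'y] /=; rewrite mem_filter.
    by case/andP=> /asboolP.
  by apply/andP; split; [apply/asboolP | apply: S's'].
have /nmin : P (size [seq y <- s' | `[< S' y >]]).
  apply/asboolP; eexists; first by reflexivity.
  by rewrite S'E; split=> //; apply: subset_trans S's' s's.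
rewrite -s'n leqNgt size_filter => /negP[].
rewrite -(count_predC (fun y => `[< S' y >]) s') -addn1 leq_add2l.
by rewrite -has_count; apply/hasP; exists x => //=; apply/negP => /asboolP.
Qed.

End MinimalGenerators.

(** * Finite generation of admissible ideals *)

Section FinitelyGenerated.
Variables (k : fieldType) (Q : quiver).

(** A vertex with a list of at most [n] arrows ranges over a finite type; [insub] keeps the pairs
    that are paths. *)
Lemma finitely_many_bounded_paths n : exists s : seq (qpath Q),
  forall p, (size (parrows p) <= n)%N -> p \in s.
Proof.
pose c (x : vertex Q * n.-bseq (arrow Q)) := (x.1, val x.2).
exists (pmap insub [seq c x | x <- enum {: vertex Q * n.-bseq (arrow Q)}]).
move=> p pn; rewrite mem_pmap_sub; apply/mapP.
exists (pstart p, Bseq pn); first by rewrite mem_enum.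
by rewrite /c /= /pstart /parrows -surjective_pairing.
Qed.

Lemma path_elt_ideal_exp m (p : qpath Q) : (m <= size (parrows p))%N ->
  ideal_exp (arrow_ideal k Q) m (path_elt k p).
Proof.
(* The zeroth power is the ideal generated by all elements, so the base case is immediate. *)
elim: m p => [|m IHm] p; first by move=> _; apply: sub_ideal_gen.
case ps : (parrows p) => [//|a s] /= sm.
have [q qs ->] := path_elt_cons k ps.
apply: sub_ideal_gen; exists (arrow_elt k a); first by apply: sub_ideal_gen; exists a.
by exists (path_elt k q) => //; apply: IHm; rewrite qs.
Qed.

(* If [J^m] is contained in [I], then [I] is generated by its elements that are
   combinations of paths of length at most [m], and these form a
   finite-dimensional space. *)
Lemma admissible_finitely_generated (I : ideal (path_alg k Q)) :
  admissible I -> exists s : seq (path_alg k Q), ideal_gen [set` s] = I :> set _.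
Proof.
move=> [m [_ JmI _]]; have [s sP] := finitely_many_bounded_paths m.
have [L [LI sL]] := finite_span_submodule (ideal_submodule I) (map (@path_elt k Q) s).
exists L; pose U := ideal_gen [set` L].
apply/seteqP; split=> [|x Ix]; first by apply: ideal_gen_sub => y; exact: LI.
have Us y : I y -> finite_span (map (@path_elt k Q) s) y -> U y.
  move=> Iy /(sL _ Iy); apply: (finite_span_sub (W := ideal_submodule U)) => b Lb.
  exact: sub_ideal_gen.
have Ilong p : (m <= size (parrows p))%N -> I (path_elt k p).
  by move=> mp; apply/JmI/path_elt_ideal_exp.
have sshort p : (size (parrows p) <= m)%N ->
    finite_span (map (@path_elt k Q) s) (path_elt k p).
  by move=> pm; apply/mem_finite_span/map_f/sP.
(* Induction on the excess of the length over [m]. Length exactly [m] counts both as long and as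
   short: such a path lies in [I] and in the span of [s], hence in [U], which starts the
   induction. *)
have Ulong n p : size (parrows p) = (n + m)%N -> U (path_elt k p).
  elim: n p => [|n IHn] p pn.
    by apply: Us; [apply: Ilong | apply: sshort]; rewrite pn.
  case ps : (parrows p) => [|a r]; first by rewrite ps in pn.
  have [q qr ->] := path_elt_cons k ps; apply: (idealMl (i := U)); apply: IHn.
  by apply/eqP; rewrite qr -eqSS -[_.+1]/(size (a :: r)) -ps pn.
(* [y] collects the terms on paths of length at most [m] and [z] the longer ones. As [z] lies in
   [I], so does [y = x - z], and [Us] applies to [y]. *)
have [y [z [sy Uz Iz xyz]]] : exists y z, [/\ finite_span (map (@path_elt k Q) s) y,
    U z, I z & x = y + z].
  elim/path_sum_ind: x {Ix} => [|x x'|c p].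
  - exists 0, 0; split; rewrite ?addr0 //; first exact: finite_span0.
    + exact: ideal0.
    + exact: ideal0.
  - move=> [y [z [sy Uz Iz ->]]] [y' [z' [sy' Uz' Iz' ->]]].
    exists (1 *: y + y'), (z + z'); split; first exact: finite_spanP.
    + exact: idealD.
    + exact: idealD.
    + by rewrite scale1r addrACA.
  - have [pm|/ltnW mp] := leqP (size (parrows p)) m.
      exists (c *: path_elt k p + 0), 0.
      split; rewrite ?addr0 //; [|exact: ideal0 | exact: ideal0].
      rewrite -[c *: _]addr0; apply: finite_spanP (finite_span0 _).
      exact: sshort.
    exists 0, (c *: path_elt k p); split; rewrite ?add0r //; first exact: finite_span0.
    + apply: (submoduleZ (W := ideal_submodule U)).
      by apply: (Ulong (size (parrows p) - m)%N); rewrite subnK.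
    + by apply: (submoduleZ (W := ideal_submodule I)); apply: Ilong.
have Iy : I y.
  rewrite -[y](addrK z) -xyz; apply: idealD => //.
  exact: (submoduleN (W := ideal_submodule I)).
by rewrite xyz; apply: (idealD (i := U)) => //; apply: Us.
Qed.

End FinitelyGenerated.

(** * Generators of the extended ideal that avoid the new arrows *)

Section ExtendedIdealGenerators.
Variables (k : fieldType) (Q : quiver) (t : nat) (e f : 'I_t -> vertex Q).

Local Notation incl := (@incl_alg Q t e f k).

(** Paths in the support of [incl x] are images of paths of [Q], so all their arrows have the form
    [inl a]. *)
Lemma new_arrow_notin_incl i (x : path_alg k Q) :
  ~ arrow_occurs (new_arrow e f i) (incl x).
Proof.
case=> p [/negP xp ip]; apply: xp; apply/eqP; rewrite incl_algE.
elim/path_sum_ind: x => [|x y xp yp|c q]; first by rewrite linear0 /path_coef mcoeff0.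
  by rewrite linearD /path_coef mcoeffD -!/(path_coef _ _) xp yp addr0.
rewrite linearZ_LR /path_coef mcoeffZ /= incl_path_elt /path_elt peltE mcoeffU.
case: eqP => [qp|_]; last by rewrite mulr0n mulr0.
by move: ip; rewrite -qp => /mapP[].
Qed.

Lemma ext_ideal_gen (S : set (path_alg k Q)) :
  ideal_gen (incl @` S) = ext_ideal e f (ideal_gen S) :> set _.
Proof.
apply/seteqP; split.
  apply: ideal_gen_sub => _ [x Sx <-]; apply: sub_ideal_gen; exists x => //.
  exact: sub_ideal_gen.
apply: ideal_gen_sub => _ [x Sx <-] U SU.
apply: (Sx (preim_ideal (incl_lin_monoid_morphism k e f) U)) => y Sy.
by apply: SU; exists y.
Qed.

Lemma ext_ideal_minimal_generators (I : ideal (path_alg k Q)) : admissible I ->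
  exists S, minimal_generating_set (ext_ideal e f I) S /\
    forall x i, S x -> ~ arrow_occurs (new_arrow e f i) x.
Proof.
move=> /admissible_finitely_generated[L LI].
have LE : [set` map incl L] = incl @` [set` L].
  apply/seteqP; split=> [x /mapP[y Ly ->]|_ [y Ly <-]]; first by exists y.
  exact: map_f.
have [|S SL Smin] := @finite_minimal_generating_set _ _ (ext_ideal e f I)
  (map incl L).
  by rewrite LE ext_ideal_gen /ext_ideal LI.
exists S; split=> // x i /SL; rewrite LE => -[y _ <-].
exact: new_arrow_notin_incl.
Qed.

End ExtendedIdealGenerators.

(** * The two components of a trivial extension *)

Section TrivialExtensionEmbeddings.
Variables (k : fieldType) (A : kalgebra k) (P : bimodule A).

Lemma trivext_inlM (a b : A) :
  trivext_inl P (a * b) = trivext_inl P a * trivext_inl P b.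
Proof. by congr (_, _); rewrite /= lact0r ract0l addr0. Qed.

Lemma trivext_inlD (a b : A) :
  trivext_inl P (a + b) = trivext_inl P a + trivext_inl P b.
Proof. by congr (_, _); rewrite /= addr0. Qed.

Lemma trivext_inlP (c : k) (a b : A) :
  trivext_inl P (c *: a + b) = c *: trivext_inl P a + trivext_inl P b.
Proof. by congr (_, _); rewrite /= scaler0 addr0. Qed.

Definition trivext_inr (p : P) : trivext P := (0, p).

Lemma trivext_inl_inr (a : A) p :
  trivext_inl P a * trivext_inr p = trivext_inr (lact a p).
Proof. by congr (_, _); rewrite /= ?mulr0 // ract0l addr0. Qed.

Lemma trivext_inr_inl (a : A) p :
  trivext_inr p * trivext_inl P a = trivext_inr (ract p a).
Proof. by congr (_, _); rewrite /= ?mul0r // lact0r add0r. Qed.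

Lemma trivext_inrD p q : trivext_inr (p + q) = trivext_inr p + trivext_inr q.
Proof. by congr (_, _); rewrite /= addr0. Qed.

Lemma trivext_inl_inr_split (x : trivext P) :
  x = trivext_inl P (x : A * P).1 + trivext_inr (x : A * P).2.
Proof. by case: x => a p; congr (_, _); rewrite /= ?addr0 ?add0r. Qed.

End TrivialExtensionEmbeddings.

(** * The map from the trivial extension to [kQ/I] *)

Section TrivialExtensionIsomorphism.
Variables (k : fieldType) (Q : quiver) (I0 : ideal (path_alg k Q)).
Variables (t : nat) (e f : 'I_t -> vertex Q).
Hypothesis fe0 : forall i j (x : quot_alg I0),
  quot_vertex I0 (f j) * x * quot_vertex I0 (e i) = 0.

Local Notation Gamma := (quot_alg I0).
Local Notation P := (proj_bimodule e f I0).
Local Notation Lambda := (trivext P).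
Local Notation I := (ext_ideal e f I0).
Local Notation B := (quot_alg I).
Local Notation ve := (fun i => quot_vertex I0 (e i)).
Local Notation vf := (fun i => quot_vertex I0 (f i)).

Definition ext_pi (x : path_alg k Q) : B := quot_alg_pi I (incl_lin e f x).
Fact ext_pi_is_linear : linear ext_pi.
Proof. by move=> c x y; rewrite /ext_pi !linearP. Qed.
HB.instance Definition _ := GRing.isLinear.Build k (path_alg k Q) B *:%R
  ext_pi ext_pi_is_linear.

Lemma ext_pi_eq0 x : I0 x -> ext_pi x = 0.
Proof.
by move=> Ix; apply/quot_alg_pi_eq0/sub_ideal_gen; exists x.
Qed.

Lemma ext_pi_monoid_morphism : monoid_morphism ext_pi.
Proof.
have [incl1 inclM] := incl_lin_monoid_morphism k e f.
by split=> [|x y]; rewrite /ext_pi ?incl1 ?inclM ?rmorph1 ?rmorphM.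
Qed.

Definition quot_incl : Gamma -> B := quot_alg_lift ext_pi_eq0.
HB.instance Definition _ := GRing.Linear.on quot_incl.

Lemma quot_incl_pi x : quot_incl (quot_alg_pi I0 x) = quot_alg_pi I (incl_lin e f x).
Proof. exact: quot_alg_liftE. Qed.

Lemma quot_incl1 : quot_incl 1 = 1.
Proof. exact: (quot_alg_lift_monoid_morphism ext_pi_eq0 ext_pi_monoid_morphism).1. Qed.

Lemma quot_inclM x y : quot_incl (x * y) = quot_incl x * quot_incl y.
Proof. exact: (quot_alg_lift_monoid_morphism ext_pi_eq0 ext_pi_monoid_morphism).2. Qed.

Lemma quot_incl_vertex v : quot_incl (quot_vertex I0 v) = quot_vertex I v.
Proof. by rewrite quot_incl_pi incl_vertex. Qed.

Definition quot_new_arrow i : B := quot_alg_pi I (arrow_elt k (new_arrow e f i)).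
Local Notation a_ := quot_new_arrow.

Definition summand_mul i (x : lideal (ve i)) (y : rideal (vf i)) : B :=
  quot_incl (val x) * a_ i * quot_incl (val y).

Fact summand_mulPl i c x x' y :
  @summand_mul i (c *: x + x') y = c *: summand_mul x y + summand_mul x' y.
Proof.
rewrite /summand_mul -[val (c *: x + x')]/(c *: val x + val x').
by rewrite linearP !mulrDl !kscalerAl.
Qed.

Fact summand_mulPr i c x y y' :
  @summand_mul i x (c *: y + y') = c *: summand_mul x y + summand_mul x y'.
Proof.
rewrite /summand_mul -[val (c *: y + y')]/(c *: val y + val y').
by rewrite linearP mulrDr kscalerAr.
Qed.

Definition summand_map i : tensor (lideal (ve i)) (rideal (vf i)) -> B :=
  tensor_lift (@summand_mul i).
HB.instance Definition _ i := GRing.isLinear.Build k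
  (tensor (lideal (ve i)) (rideal (vf i))) B *:%R (@summand_map i)
  (tensor_lift_is_linear (@summand_mulPl i) (@summand_mulPr i)).

Lemma summand_map_tens i x y :
  @summand_map i (tens x y) = quot_incl (val x) * a_ i * quot_incl (val y).
Proof. exact: (tensor_liftE (@summand_mulPl i) (@summand_mulPr i)). Qed.

Lemma summand_mapD i x y :
  @summand_map i (x + y) = summand_map x + summand_map y.
Proof. exact: linearD. Qed.

Definition proj_bimodule_map (p : P) : B := \sum_i summand_map (dsum_proj p i).
Local Notation theta := proj_bimodule_map.

Fact proj_bimodule_map_is_linear : linear theta.
Proof.
move=> c p q; rewrite scaler_sumr -big_split; apply: eq_bigr => i _.
by rewrite dsum_projD dsum_projZ linearP.
Qed.
HB.instance Definition _ := GRing.isLinear.Build k P B *:%R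
  proj_bimodule_map proj_bimodule_map_is_linear.

Lemma proj_bimodule_mapD p q : theta (p + q) = theta p + theta q.
Proof. exact: linearD. Qed.

(** With its right-handed counterpart, this makes [theta] a bimodule map along [quot_incl], which
    accounts for the mixed terms of a product in the trivial extension. *)
Lemma proj_bimodule_map_lact a p : theta (lact a p) = quot_incl a * theta p.
Proof.
rewrite mulr_sumr; apply: eq_bigr => i _; rewrite dsumE.
elim/tensor_ind: (dsum_proj p i) => [|x y Hx Hy|x y].
- by rewrite lact0r linear0 mulr0.
- by rewrite lactDr !summand_mapD mulrDr Hx Hy.
rewrite /lact /= tensor_mapE /= !summand_map_tens /= quot_inclM.
by rewrite !mulrA.
Qed.

Lemma proj_bimodule_map_ract a p : theta (ract p a) = theta p * quot_incl a.
Proof.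
rewrite mulr_suml; apply: eq_bigr => i _; rewrite dsumE.
elim/tensor_ind: (dsum_proj p i) => [|x y Hx Hy|x y].
- by rewrite ract0l linear0 mul0r.
- by rewrite ractDl !summand_mapD mulrDl Hx Hy.
rewrite /ract /= tensor_mapE /= !summand_map_tens /= quot_inclM.
by rewrite !mulrA.
Qed.

Lemma proj_bimodule_map_mul0 p q : theta p * theta q = 0.
Proof.
rewrite mulr_suml big1 // => i _; rewrite mulr_sumr big1 // => j _.
elim/tensor_ind: (dsum_proj p i) => [|x y Hx Hy|x y].
- by rewrite linear0 mul0r.
- by rewrite summand_mapD mulrDl Hx Hy addr0.
elim/tensor_ind: (dsum_proj q j) => [|x' y' Hx Hy|x' y'].
- by rewrite linear0 mulr0.
- by rewrite summand_mapD mulrDr Hx Hy addr0.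
rewrite !summand_map_tens.
(* [y] starts with [f i] and [x'] ends with [e j], so [fe0] applies to their product. *)
have yx' : val y * val x' = 0.
  case: y x' => [y /= /asboolP[z ->]] [x' /= /asboolP[z' ->]].
  by rewrite mulrA -[_ * z * z']mulrA fe0.
rewrite -!mulrA [quot_incl (val y) * _]mulrA -quot_inclM yx' linear0.
by rewrite mul0r !mulr0.
Qed.

Definition trivext_map (x : Lambda) : B :=
  quot_incl (x : Gamma * P).1 + theta (x : Gamma * P).2.
Fact trivext_map_is_linear : linear trivext_map.
Proof.
move=> c [a p] [b q]; rewrite /trivext_map /=.
by rewrite !linearP scalerDr addrACA.
Qed.
HB.instance Definition _ := GRing.isLinear.Build k Lambda B *:%R
  trivext_map trivext_map_is_linear.

(** Beyond the terms of the product in the trivial extension, the expansion contains only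
    [theta p * theta q], which vanishes. *)
Lemma trivext_map_monoid_morphism : monoid_morphism trivext_map.
Proof.
split; first by rewrite /trivext_map /= quot_incl1 linear0 addr0.
move=> [a p] [b q]; rewrite /trivext_map /=.
rewrite proj_bimodule_mapD proj_bimodule_map_lact proj_bimodule_map_ract quot_inclM.
by rewrite mulrDl !mulrDr proj_bimodule_map_mul0 addr0 addrA.
Qed.

Lemma trivext_map_inl a : trivext_map (trivext_inl P a) = quot_incl a.
Proof. by rewrite /trivext_map /= linear0 addr0. Qed.

(** * The map from [kQ/I] to the trivial extension *)

Lemma quot_vertex_mul v w :
  quot_vertex I0 v * quot_vertex I0 w = if v == w then quot_vertex I0 v else 0.
Proof.
by rewrite /quot_vertex -rmorphM vertex_elt_mul; case: eqP; rewrite ?raddf0.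
Qed.

Lemma quot_vertex_idem v : quot_vertex I0 v * quot_vertex I0 v = quot_vertex I0 v.
Proof. by rewrite quot_vertex_mul eqxx. Qed.

(** The element [e_i (x) f_i] of the [i]-th summand, written with the index [j] so that its type is
    that of the [j]-th component. *)
Definition summand_gen i : P := dsum_mk (fun j =>
  if j == i then tens (lideal_gen (ve j)) (rideal_gen (vf j)) else 0).

(** With [ract_summand_gen], this shows that [summand_gen i] behaves like an arrow from [e i] to
    [f i], as an image of [new_arrow e f i] must. *)
Lemma lact_summand_gen i : lact (ve i) (summand_gen i) = summand_gen i.
Proof.
apply: dsumP => j; rewrite !dsumE; case: eqP => [->|_]; last by rewrite lact0r.
apply: etrans (tensor_mapE _ _ _ _) _; congr tens.
exact: (lideal_mul_gen (quot_vertex_idem (e i)) (lideal_gen (ve i))).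
Qed.

Lemma ract_summand_gen i : ract (summand_gen i) (vf i) = summand_gen i.
Proof.
apply: dsumP => j; rewrite !dsumE; case: eqP => [->|_]; last by rewrite ract0l.
apply: etrans (tensor_mapE _ _ _ _) _; congr tens.
exact: (rideal_mul_gen (quot_vertex_idem (f i)) (rideal_gen (vf i))).
Qed.

Definition trivext_arrow (b : arrow (add_arrows e f)) : Lambda :=
  match b with
  | inl a => trivext_inl P (quot_alg_pi I0 (arrow_elt k a))
  | inr i => trivext_inr (P := P) (summand_gen i)
  end.

Definition trivext_vertex (v : vertex (add_arrows e f)) : Lambda :=
  trivext_inl P (quot_vertex I0 v).

Definition path_trivext : path_alg k (add_arrows e f) -> Lambda :=
  path_lin_ext (path_value trivext_vertex trivext_arrow).
HB.instance Definition _ := GRing.Linear.on path_trivext.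

Lemma trivext_vertex_mul v w : trivext_vertex v * trivext_vertex w =
  if v == w then trivext_vertex v else 0.
Proof. by rewrite -trivext_inlM quot_vertex_mul; case: eqP. Qed.

Lemma trivext_vertex_sum : \sum_v trivext_vertex v = 1.
Proof.
rewrite -(big_morph (trivext_inl P) (trivext_inlD P) (erefl _)).
rewrite -[RHS]/(trivext_inl P 1); congr trivext_inl.
have <- : quot_alg_pi I0 (\sum_v vertex_elt k v) = 1 by exact: rmorph1.
by rewrite linear_sum.
Qed.

Lemma trivext_vertex_arrow b : trivext_vertex (src b) * trivext_arrow b = trivext_arrow b.
Proof.
case: b => [a|i]; last by rewrite trivext_inl_inr lact_summand_gen.
by rewrite -trivext_inlM -rmorphM vertex_arrow_elt.
Qed.

Lemma trivext_arrow_vertex b : trivext_arrow b * trivext_vertex (tgt b) = trivext_arrow b.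
Proof.
case: b => [a|i]; last by rewrite trivext_inr_inl ract_summand_gen.
by rewrite -trivext_inlM -rmorphM arrow_vertex_elt.
Qed.

Lemma path_trivext_monoid_morphism : monoid_morphism path_trivext.
Proof.
apply: path_value_monoid_morphism.
- exact: trivext_vertex_mul.
- exact: trivext_vertex_sum.
- exact: trivext_arrow_vertex.
Qed.

Lemma path_trivext_vertex v : path_trivext (vertex_elt k v) = trivext_vertex v.
Proof. exact: path_value_vertex. Qed.

Lemma path_trivext_arrow b : path_trivext (arrow_elt k b) = trivext_arrow b.
Proof. exact: (path_value_arrow trivext_vertex_arrow). Qed.

(** Both sides are algebra morphisms in [x], so vertices and arrows of [Q] suffice. Hence
    [path_trivext] kills the generators of [I]. *)
Lemma path_trivext_incl x :
  path_trivext (incl_lin e f x) = trivext_inl P (quot_alg_pi I0 x).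
Proof.
pose inl_pi x := trivext_inl P (quot_alg_pi I0 x).
have inl_pi_lin : linear inl_pi.
  by move=> c y z; rewrite -trivext_inlP /inl_pi linearP.
pose G := HB.pack_for {linear path_alg k Q -> Lambda} inl_pi
  (GRing.isLinear.Build k (path_alg k Q) Lambda *:%R inl_pi inl_pi_lin).
apply: (path_alg_morphism_eq (F := path_trivext \o incl_lin e f) (G := G)) x.
- have [i1 iM] := incl_lin_monoid_morphism k e f.
  have [p1 pM] := path_trivext_monoid_morphism.
  by split=> [|x y]; rewrite /= ?i1 ?p1 ?iM ?pM.
- by split=> [|x y] /=; rewrite /inl_pi ?rmorph1 // rmorphM trivext_inlM.
- by move=> v /=; rewrite incl_vertex path_trivext_vertex.
- by move=> a /=; rewrite incl_arrow path_trivext_arrow.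
Qed.

Lemma path_trivext_eq0 x : I x -> path_trivext x = 0.
Proof.
apply: (ideal_gen_eq0 path_trivext_monoid_morphism) => _ [y Iy <-].
apply: etrans (path_trivext_incl y) _.
by rewrite (quot_alg_pi_eq0 I0 y).2.
Qed.

Definition trivext_inv : B -> Lambda := quot_alg_lift path_trivext_eq0.
HB.instance Definition _ := GRing.Linear.on trivext_inv.

Lemma trivext_inv_pi x : trivext_inv (quot_alg_pi I x) = path_trivext x.
Proof. exact: quot_alg_liftE. Qed.

Lemma trivext_invM x y : trivext_inv (x * y) = trivext_inv x * trivext_inv y.
Proof.
exact: (quot_alg_lift_monoid_morphism path_trivext_eq0
  path_trivext_monoid_morphism).2.
Qed.

Lemma trivext_invD x y : trivext_inv (x + y) = trivext_inv x + trivext_inv y.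
Proof. exact: linearD. Qed.

(** * The two maps are mutually inverse *)

Lemma trivext_inv_incl a : trivext_inv (quot_incl a) = trivext_inl P a.
Proof.
elim/quot_alg_ind: a => x.
by rewrite quot_incl_pi trivext_inv_pi path_trivext_incl.
Qed.

(** [q] is [z] placed in the [i]-th summand; describing it by its components avoids a transport
    along [j = i] in the dependent sum. *)
Lemma trivext_inv_summand i z : exists q : P,
  [/\ trivext_inv (@summand_map i z) = trivext_inr q, dsum_proj q i = z &
      forall j, j != i -> dsum_proj q j = 0].
Proof.
elim/tensor_ind: z => [|x y [q [xq qi qj]] [q' [yq' qi' qj']]|x y].
- by exists 0; split=> [||j _]; rewrite ?dsumE // !linear0.
- exists (q + q'); split=> [||j ji].
  + by rewrite summand_mapD trivext_invD trivext_inrD xq yq'.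
  + by rewrite dsum_projD qi qi'.
  + by rewrite dsum_projD qj ?qj' ?addr0.
(* A pure tensor [x (x) y] is [x (e_i (x) f_i) y]. *)
exists (ract (lact (val x) (summand_gen i)) (val y)); split=> [||j /negPf ji].
- rewrite summand_map_tens !trivext_invM !trivext_inv_incl.
  rewrite -trivext_inr_inl -trivext_inl_inr; congr (_ * _ * _).
  by rewrite /quot_new_arrow trivext_inv_pi path_trivext_arrow.
- rewrite !dsumE eqxx; apply: etrans (congr1 _ (tensor_mapE _ _ _ _)) _.
  apply: etrans (tensor_mapE _ _ _ _) _; congr tens.
  + exact: (lideal_mul_gen (quot_vertex_idem (e i)) x).
  + exact: (rideal_mul_gen (quot_vertex_idem (f i)) y).
- by rewrite !dsumE ji lact0r ract0l.
Qed.

Lemma trivext_inv_proj_bimodule_map p : trivext_inv (theta p) = trivext_inr p.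
Proof.
have [q qP] := choice (fun i => trivext_inv_summand (dsum_proj p i)).
rewrite (big_morph trivext_inv trivext_invD (linear0 _)).
rewrite (eq_bigr (fun i => trivext_inr (q i))) => [|i _]; last by case: (qP i).
rewrite -(big_morph (@trivext_inr _ _ P) (@trivext_inrD _ _ P) (erefl _)).
congr trivext_inr; apply: dsumP => j.
rewrite (big_morph (fun x : P => dsum_proj x j)
  (fun x y : P => dsum_projD x y j) (dsumE _ j)).
rewrite (bigD1 j) //= big1 ?addr0; first by case: (qP j).
by move=> i ij; case: (qP i) => _ _; apply; rewrite eq_sym.
Qed.

Lemma trivext_mapK : cancel trivext_map trivext_inv.
Proof.
move=> [a p]; rewrite /trivext_map trivext_invD trivext_inv_incl.
by rewrite trivext_inv_proj_bimodule_map; congr (_, _); rewrite /= ?addr0 ?add0r.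
Qed.

Lemma trivext_map_inr p : trivext_map (trivext_inr p) = theta p.
Proof. by rewrite /trivext_map /= linear0 add0r. Qed.

(** The image of [e_i (x) f_i] is [e_i a_i f_i], and [a_i] absorbs its end vertices. *)
Lemma proj_bimodule_map_gen i : theta (summand_gen i) = quot_new_arrow i.
Proof.
rewrite /theta (bigD1 i) //= big1 ?addr0 => [|j ji].
  rewrite dsumE eqxx summand_map_tens /= !quot_incl_vertex.
  have ae : quot_new_arrow i * quot_vertex I (f i) = quot_new_arrow i.
    apply: etrans (esym (rmorphM (quot_alg_pi I) _ _)) _.
    exact: congr1 (arrow_vertex_elt k (new_arrow e f i)).
  rewrite -mulrA ae; apply: etrans (esym (rmorphM (quot_alg_pi I) _ _)) _.
  exact: congr1 (vertex_arrow_elt k (new_arrow e f i)).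
by rewrite dsumE (negPf ji) linear0.
Qed.

(** After composition with the quotient map, both sides are morphisms from the path algebra, so
    vertices, old arrows and new arrows suffice. *)
Lemma trivext_invK : cancel trivext_inv trivext_map.
Proof.
elim/quot_alg_ind => x; rewrite trivext_inv_pi.
apply: (path_alg_morphism_eq (F := trivext_map \o path_trivext)
  (G := quot_alg_pi I)) x.
- have [i1 iM] := trivext_map_monoid_morphism.
  have [p1 pM] := path_trivext_monoid_morphism.
  by split=> [|x y]; rewrite /= ?p1 ?i1 ?pM ?iM.
- by split=> [|x y]; rewrite ?rmorph1 ?rmorphM.
- by move=> v /=; rewrite path_trivext_vertex trivext_map_inl quot_incl_vertex.
- move=> [a|i] /=; rewrite path_trivext_arrow /=.
    by rewrite trivext_map_inl quot_incl_pi incl_arrow.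
  by rewrite trivext_map_inr proj_bimodule_map_gen.
Qed.

(** * Vanishing of homomorphisms over the trivial extension *)

Lemma lact_vertex_eq0 j (p : P) : lact (vf j) p = 0.
Proof.
apply: dsumP => l; rewrite !dsumE.
elim/tensor_ind: (dsum_proj p l) => [|x y Hx Hy|x y]; first by rewrite lact0r.
  by rewrite lactDr Hx Hy addr0.
(* The left factor [x] ends with [e l], so [fe0] annihilates it after multiplication by [f j]. *)
apply: etrans (tensor_mapE _ _ _ _) _; rewrite -[RHS](tens0l _ y); congr tens.
by apply: val_inj; case: x => x /= /asboolP[z ->]; rewrite mulrA fe0.
Qed.

Lemma trivext_vertex_mul0 i j (x : Lambda) :
  trivext_inl P (vf j) * x * trivext_inl P (ve i) = 0.
Proof.
rewrite [x]trivext_inl_inr_split mulrDr mulrDl trivext_inl_inr lact_vertex_eq0.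
by rewrite mul0r addr0 -!trivext_inlM fe0.
Qed.

End TrivialExtensionIsomorphism.

Theorem corollary4p3 (k : fieldType) (Q0 : quiver) (I0 : ideal (path_alg k Q0))
    (t : nat) (e f : 'I_t -> vertex Q0) :
  admissible I0 ->
  (forall i j, Hom_zero (quot_vertex I0 (e i)) (quot_vertex I0 (f j))) ->
  let Gamma := quot_alg I0 in
  let P : bimodule Gamma := proj_bimodule e f I0 in
  let Lambda := trivext P in
  let I : ideal (path_alg k (add_arrows e f)) := ext_ideal e f I0 in
  let eL (v : vertex Q0) : Lambda := trivext_inl P (quot_vertex I0 v) in
  (exists phi : {linear Lambda -> quot_alg I},
     alg_isomorphism phi /\ forall v, phi (eL v) = quot_vertex I v) /\
  ((exists S : set (path_alg k (add_arrows e f)),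
      minimal_generating_set I S /\
      forall x i, S x -> ~ arrow_occurs (new_arrow e f i) x) /\
   forall i j, Hom_zero (eL (e i)) (eL (f j))).
Proof.
move=> adm hom0 Gamma P Lambda I eL.
have fe0 i j (x : Gamma) : quot_vertex I0 (f j) * x * quot_vertex I0 (e i) = 0.
  exact: (Hom_zeroP _ (quot_vertex_idem I0 (e i))).1 (hom0 i j) x.
split.
  exists (trivext_map (I0 := I0) (e := e) (f := f)); split; last first.
    move=> v; apply: etrans (trivext_map_inl e f (quot_vertex I0 v)) _.
    exact: quot_incl_vertex.
  split; last exact: trivext_map_monoid_morphism.
  by exists (@trivext_inv _ _ I0 _ e f); [apply: trivext_mapK | apply: trivext_invK].
split; first exact: ext_ideal_minimal_generators.
move=> i j; apply/Hom_zeroP; last exact: trivext_vertex_mul0.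
by rewrite /eL -trivext_inlM quot_vertex_idem.
Qed.
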